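(* Let $n\ge2$ and let $L$ be the $n$-th order differential operator in $L^2(0,1)$ (not necessarily dissipative) defined by the expression $l(y)=D^ny+\sum_{k=0}^{n-2}p_k(x)D^ky$, $D=-i\,d/dx$, $p_k\in L^1(0,1)$, and $n$ linearly independent normalized boundary conditions with leading coefficient vectors $b_j^0,b_j^1$, $j=0,\dots,n-1$. For $0<\varepsilon<\pi$ put $$T_\varepsilon^+=\{\lambda:\varepsilon\le\arg\lambda\le\pi-\varepsilon\},\qquad T_\varepsilon^-=\{\lambda:\pi+\varepsilon\le\arg\lambda\le2\pi-\varepsilon\}.$$ 1. Let $\{\lambda_m\}_{m\ge1}\subset T_\varepsilon^-$ be a sequence with $|\lambda_m|\to\infty$ such that, for some constant $C$ independent of $m$, every $\lambda_m$ is in the resolvent set of $L$ and $\|(L-\lambda_m)^{-1}\|\le C|\lambda_m|^{-1}$. Let $p$, the matrix $\mathbf{\Delta}$ and the characteristic matrix $A$ be those corresponding to the sector $S_1$, and write $\mathbf{\Delta}(\lambda_m)=\mathbf{\Delta}(\varrho_m)$, $A(\lambda_m)=A(\varrho_m)$ with $\varrho_m=\lambda_m^{1/n}$. Then the following limits exist: $$\lim_{m\to\infty}\mathbf{\Delta}(\lambda_m)=:\mathbf{\Delta}_\infty=\mathbf{\Theta}_p(b^0,b^1),$$ $$\lim_{m\to\infty}A(\lambda_m)=:A_\infty=\mathbf{\Theta}_p(b^0,b^1)^{-1}\,\mathbf{\Theta}_p(b^1,b^0)\,\mathcal{D},$$ where $\mathcal{D}=\frac1{2\pi}\operatorname{diag}(\varepsilon_0,\dots,\varepsilon_{p-1},-\varepsilon_p,\dots,-\varepsilon_{n-1})$.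 In particular $\mathbf{\Theta}_p(b^0,b^1)$ is invertible, and none of the matrices $\mathbf{\Delta}_\infty$, $\mathbf{\Theta}_p(b^0,b^1)$, $\mathbf{\Theta}_p(b^1,b^0)$, $\mathcal{D}$, $A_\infty$ is the zero matrix. 2. The same relations hold if such a sequence exists in $T_\varepsilon^+$, with $p$, $\mathbf{\Delta}$, $A$ now corresponding to the sector $S_0$.
   Context: Boundary conditions: for $j=0,\dots,n-1$, $U_j(y)\equiv b_j^0D^jy(0)+b_j^1D^jy(1)+\ldots=0$, where the dots denote a linear combination (with vector coefficients) of $D^ky(0),D^ky(1)$ with $k<j$. Here $b_j^0,b_j^1$ are column vectors of length $r_j$, $0\le r_j\le2$, $\sum_jr_j=n$, $\operatorname{rank}(b_j^0\;b_j^1)=r_j$ (no condition of order $j$ if $r_j=0$; $(b_j^0\;b_j^1)$ is the identity if $r_j=2$). $L$ acts by $Ly=l(y)$ on all $y$ with $y,\dots,y^{(n-1)}$ absolutely continuous, $l(y)\in L^2(0,1)$, $U_j(y)=0$ for all $j$. Write $U_j=U_j^0+U_j^1$, where $U_j^0$ (resp. $U_j^1$) collects the terms at the point $0$ (resp. $1$). Regularity matrices: $\varepsilon_k=\exp(2\pi ik/n)$; $B_k^i\in\mathbb{C}^n$ ($i=0,1$) is the column with stacked blocks $b_j^i\varepsilon_k^j$, $j=0,\dots,n-1$; $\mathbf{\Theta}_p(b^0,b^1)$ is the $n\times n$ matrix with columns $B_0^0,\dots,B_{p-1}^0,B_p^1,\dots,B_{n-1}^1$, and $\mathbf{\Theta}_p(b^1,b^0)$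 is the matrix with columns $B_0^1,\dots,B_{p-1}^1,B_p^0,\dots,B_{n-1}^0$. Sectors and solutions: $\varrho=\lambda^{1/n}$ with $\arg\varrho=\arg\lambda/n$, $0\le\arg\lambda<2\pi$; $S_k=\{\varrho:\pi k/n\le\arg\varrho<\pi(k+1)/n\}$, so $\lambda$ in the open upper (lower) half-plane corresponds to $\varrho$ in the interior of $S_0$ ($S_1$). In each sector, for $|\varrho|$ large, fix a fundamental system $y_0,\dots,y_{n-1}$ of solutions of $l(y)=\lambda y$ with $D^ky_j(x,\varrho)=(\varrho\varepsilon_j)^k\exp(i\varrho\varepsilon_jx)(1+O(1/\varrho))$ uniformly in $x\in[0,1]$, $j,k=0,\dots,n-1$. For a sector, $p$ is the number such that for $\varrho$ in its interior $\operatorname{Im}(\varrho\varepsilon_j)>0$ (decaying solution) exactly for $j<p$; thus $p=q$ in both $S_0$ and $S_1$ if $n=2q$, while for $n=2q+1$ one has $p=q+1$ in $S_0$ and $p=q$ in $S_1$. Put $z_k=y_k$ for $k<p$ and $z_k=y_k/\exp(i\varrho\varepsilon_k)$ for $k\ge p$. Matrices: $\mathbf{\Delta}(\varrho)$ is the $n\times n$ matrix whose $k$-th column is the stack of $\varrho^{-j}U_j(z_k)$, $j=0,\dots,n-1$. The characteristic matrix $A(\varrho)$ is the $n\times n$ matrix with columns $A_0,\dots,A_{n-1}$, $A_t=(a_{tk})_{k=0}^{n-1}$, determined (when $\det\mathbf{\Delta}(\varrho)\ne0$) by $$\mathbf{\Delta}(\varrho)A_t=\frac{\varepsilon_t}{2\pi}\beta_t\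 (t<p),\qquad \mathbf{\Delta}(\varrho)A_t=-\frac{\varepsilon_t}{2\pi}\beta_t\ (t\ge p),$$ where $\beta_t$ is the stack over $j$ of $\varrho^{-j}U_j^1(y_t)e^{-i\varrho\varepsilon_t}$ if $t<p$ (so $\beta_t=B_t^1+O(1/\varrho)$) and of $\varrho^{-j}U_j^0(y_t)$ if $t\ge p$ (so $\beta_t=B_t^0+O(1/\varrho)$). Both $\mathbf{\Delta}(\varrho)$ and $A(\varrho)$ are defined for $|\varrho|$ sufficiently large (and $\lambda$ not an eigenvalue), which suffices for the limits. *)

(* Defs.v *)
From HB Require Import structures.
From mathcomp Require Import all_boot all_order all_algebra.
From mathcomp Require Import all_classical all_reals all_analysis.
From mathcomp Require Import complex.
Set Implicit Arguments.
Unset Strict Implicit.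
Unset Printing Implicit Defensive.
Import Order.TTheory GRing.Theory Num.Theory.
Import numFieldNormedType.Exports.
Import ComplexField.Normc.
Local Open Scope classical_set_scope.
Local Open Scope ring_scope.
Local Open Scope complex_scope.

(* The real-valued modulus of a complex number is [normc]; the topology of the
   complex field [R[i]] is the norm topology carried by its alias [R[i]^o]. *)

Definition cexp (R : realType) (z : R[i]) : R[i] :=
  (expR (complex.Re z))%:C * (cos (complex.Im z) +i* sin (complex.Im z)).

(* Argument in [0, 2 pi[; irrelevant at 0. *)
Definition argc (R : realType) (z : R[i]) : R :=
  xget 0 [set t : R | 0 <= t < 2 * pi /\ z = (normc z)%:C * cexp (t *i)].

Definition root_unity (R : realType) (n k : nat) : R[i] :=
  cexp ((2 * pi * k%:R / n%:R) *i).

Definition rho_of (R : realType) (n : nat) (lam : R[i]) : R[i] :=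
  (normc lam `^ (n%:R^-1))%:C * cexp ((argc lam / n%:R) *i).

Definition Tplus (R : realType) (eps : R) : set R[i] :=
  [set lam | lam != 0 /\ eps <= argc lam <= pi - eps].

Definition Tminus (R : realType) (eps : R) : set R[i] :=
  [set lam | lam != 0 /\ pi + eps <= argc lam <= 2 * pi - eps].

Definition sector (R : realType) (n k : nat) : set R[i] :=
  [set rho | rho != 0 /\
     pi * k%:R / n%:R <= argc rho < pi * k.+1%:R / n%:R].

Definition sector_interior (R : realType) (n k : nat) : set R[i] :=
  [set rho | rho != 0 /\
     pi * k%:R / n%:R < argc rho < pi * k.+1%:R / n%:R].

(* Differential operators on [0, 1].  Derivatives are taken within [0, 1],
   hence are one-sided at the endpoints. *)

Definition diff_quot (R : realType) (y : R -> R[i]) (x t : R) : R[i]^o :=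
  (y t - y x) / (t - x)%:C.

Definition derivable01 (R : realType) (y : R -> R[i]) (x : R) : Prop :=
  cvg (diff_quot y x t @[t --> within `[0, 1] (x^')]).

(* D = - i d/dx; a junk value where [y] is not derivable. *)
Definition Dop (R : realType) (y : R -> R[i]) (x : R) : R[i] :=
  - 'i%C * lim (diff_quot y x t @[t --> within `[0, 1] (x^')]).

Definition Dn (R : realType) (k : nat) (y : R -> R[i]) : R -> R[i] :=
  iter k (@Dop R) y.

Definition abs_cont01 (R : realType) (f : R -> R[i]) : Prop :=
  forall e : R, 0 < e -> exists2 d : R, 0 < d &
    forall (N : nat) (a b : 'I_N -> R),
      (forall i, 0 <= a i <= b i /\ b i <= 1) ->
      trivIset setT (fun i => [set` `]a i, b i[]) ->
      \sum_i (b i - a i) < d ->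
      \sum_i normc (f (b i) - f (a i)) < e.

(* [y, ..., y^(n-1)] exist on [0, 1] and are absolutely continuous. *)
Definition regular (R : realType) (n : nat) (y : R -> R[i]) : Prop :=
  (forall k : nat, (k < n.-1)%N ->
     forall x : R, x \in `[0, 1] -> derivable01 (Dn k y) x) /\
  (forall k : nat, (k < n)%N -> abs_cont01 (Dn k y)).

Definition L1_01 (R : realType) (f : R -> R[i]) : Prop :=
  lebesgue_measure.-integrable `[0, 1] (fun x => (complex.Re (f x))%:E) /\
  lebesgue_measure.-integrable `[0, 1] (fun x => (complex.Im (f x))%:E).

Definition L2norm (R : realType) (f : R -> R[i]) : \bar R :=
  Lnorm lebesgue_measure 2%:E ((fun x => (normc (f x))%:E) \_ `[0, 1]).

Definition L2_01 (R : realType) (f : R -> R[i]) : Prop :=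
  [/\ @measurable_fun _ _ R R `[0, 1] (fun x => complex.Re (f x)),
      @measurable_fun _ _ R R `[0, 1] (fun x => complex.Im (f x)) &
      (L2norm f < +oo)%E].

Definition ae01 (R : realType) (P : R -> Prop) : Prop :=
  {ae (@lebesgue_measure R), forall x, x \in `[0, 1] -> P x}.

Definition l_expr (R : realType) (n : nat) (pc : 'I_n.-1 -> R -> R[i])
    (y : R -> R[i]) (x : R) : R[i] :=
  Dn n y x + \sum_(k < n.-1) pc k x * Dn k y x.

(* [l(y) = g] almost everywhere, for [y] having absolutely continuous
   derivatives up to order n - 1; the derivative of order n is only required
   to exist almost everywhere. *)
Definition l_eq (R : realType) (n : nat) (pc : 'I_n.-1 -> R -> R[i])
    (y g : R -> R[i]) : Prop :=
  regular n y /\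
  ae01 (fun x => derivable01 (Dn n.-1 y) x /\ l_expr pc y x = g x).

(* Normalized boundary conditions.  The condition of order j has length
   [bc_r j]; [bc_c0 j k], [bc_c1 j k] are the coefficients of D^k y(0),
   D^k y(1) in the lower order terms, and matter only for k < j. *)
Record bdry_cond (R : realType) (n : nat) := BdryCond {
  bc_r : 'I_n -> nat;
  bc_r_le2 : forall j, (bc_r j <= 2)%N;
  bc_r_sum : (\sum_(j < n) bc_r j)%N = n;
  bc_b0 : forall j, 'cV[R[i]]_(bc_r j);
  bc_b1 : forall j, 'cV[R[i]]_(bc_r j);
  bc_c0 : forall j, 'I_n -> 'cV[R[i]]_(bc_r j);
  bc_c1 : forall j, 'I_n -> 'cV[R[i]]_(bc_r j);
  bc_rank : forall j, \rank (row_mx (bc_b0 j) (bc_b1 j)) = bc_r j;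
  bc_id : forall j, bc_r j = 2%N -> forall i l,
    row_mx (bc_b0 j) (bc_b1 j) i l = (nat_of_ord i == nat_of_ord l)%:R
}.

Definition U0 (R : realType) (n : nat) (B : bdry_cond R n) (j : 'I_n)
    (y : R -> R[i]) : 'cV[R[i]]_(bc_r B j) :=
  Dn j y 0 *: bc_b0 B j + \sum_(k < n | (k < j)%N) Dn k y 0 *: bc_c0 B j k.

Definition U1 (R : realType) (n : nat) (B : bdry_cond R n) (j : 'I_n)
    (y : R -> R[i]) : 'cV[R[i]]_(bc_r B j) :=
  Dn j y 1 *: bc_b1 B j + \sum_(k < n | (k < j)%N) Dn k y 1 *: bc_c1 B j k.

Definition Ubc (R : realType) (n : nat) (B : bdry_cond R n) (j : 'I_n)
    (y : R -> R[i]) : 'cV[R[i]]_(bc_r B j) :=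
  U0 B j y + U1 B j y.

Definition stack (R : realType) (n : nat) (B : bdry_cond R n)
    (v : forall j, 'cV[R[i]]_(bc_r B j)) : 'cV[R[i]]_n :=
  castmx (bc_r_sum B, erefl 1%N) (\mxcol_(j < n) v j).

(* [L_graph pc B y g]: [y] is in the domain of L and [L y = g], functions being
   representatives of their classes in L^2(0, 1). *)
Definition L_graph (R : realType) (n : nat) (pc : 'I_n.-1 -> R -> R[i])
    (B : bdry_cond R n) (y g : R -> R[i]) : Prop :=
  [/\ l_eq pc y g, L2_01 g & forall j, Ubc B j y = 0].

(* Norm of (L - lam)^-1: the supremum of |y| over y in the domain of L with
   |(L - lam) y| <= 1. *)
Definition resolvent_norm (R : realType) (n : nat) (pc : 'I_n.-1 -> R -> R[i])
    (B : bdry_cond R n) (lam : R[i]) : \bar R :=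
  ereal_sup [set L2norm y | y in [set y : R -> R[i] |
    exists2 g : R -> R[i], L_graph pc B y g &
      (L2norm (fun x => g x - lam * y x)%R <= 1)%E]].

(* L - lam is a bijection from the domain of L onto L^2(0, 1), with bounded
   inverse. *)
Definition in_resolvent_set (R : realType) (n : nat)
    (pc : 'I_n.-1 -> R -> R[i]) (B : bdry_cond R n) (lam : R[i]) : Prop :=
  [/\ forall y g, L_graph pc B y g ->
        ae01 (fun x => g x - lam * y x = 0) -> ae01 (fun x => y x = 0),
      forall f, L2_01 f -> exists y g,
        L_graph pc B y g /\ ae01 (fun x => g x - lam * y x = f x) &
      (resolvent_norm pc B lam < +oo)%E].

Definition Bcol (R : realType) (n : nat) (B : bdry_cond R n)
    (u : forall j, 'cV[R[i]]_(bc_r B j)) (k : 'I_n) : 'cV[R[i]]_n :=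
  stack (fun j : 'I_n => root_unity R n k ^+ j *: u j).

(* [Theta p u v] has columns B_0^u, ..., B_(p-1)^u, B_p^v, ..., B_(n-1)^v. *)
Definition Theta (R : realType) (n : nat) (B : bdry_cond R n) (p : nat)
    (u v : forall j, 'cV[R[i]]_(bc_r B j)) : 'M[R[i]]_n :=
  \matrix_(i < n, k < n) (if (k < p)%N then Bcol u k else Bcol v k) i 0.

Definition Dmx (R : realType) (n p : nat) : 'M[R[i]]_n :=
  (2 * pi)^-1%:C *:
  diag_mx (\row_(k < n)
    (if (k < p)%N then root_unity R n k else - root_unity R n k)).

(* [p] is the number of decaying exponentials in the sector. *)
Definition decay_index (R : realType) (n k p : nat) : Prop :=
  (p <= n)%N /\
  forall rho : R[i], sector_interior n k rho ->
    forall j : 'I_n, 0 < complex.Im (rho * root_unity R n j) <-> (j < p)%N.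

(* [y rho j], for [rho] in the sector with |rho| large, is a fundamental system
   of solutions of [l(y) = rho^n y] with
   D^m y_j = (rho eps_j)^m exp(i rho eps_j x) (1 + O(1/rho)), uniformly. *)
Definition fundamental_system (R : realType) (n : nat)
    (pc : 'I_n.-1 -> R -> R[i]) (k : nat)
    (y : R[i] -> 'I_n -> R -> R[i]) : Prop :=
  exists r0 M : R, forall rho : R[i], sector n k rho -> r0 <= normc rho ->
  [/\ forall j, l_eq pc (y rho j) (fun x => rho ^+ n * y rho j x),
      forall c : 'I_n -> R[i],
        (forall x : R, x \in `[0, 1] -> \sum_j c j * y rho j x = 0) ->
        forall j, c j = 0 &
      forall (j m : 'I_n) (x : R), x \in `[0, 1] ->
        exists2 h : R[i], normc h <= M / normc rho &
          Dn m (y rho j) x =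
          (rho * root_unity R n j) ^+ m
          * cexp ('i%C * rho * root_unity R n j * x%:C) * (1 + h)].

Definition zsol (R : realType) (n p : nat) (y : R[i] -> 'I_n -> R -> R[i])
    (rho : R[i]) (k : 'I_n) (x : R) : R[i] :=
  if (k < p)%N then y rho k x
  else y rho k x / cexp ('i%C * rho * root_unity R n k).

Definition Delta (R : realType) (n : nat) (B : bdry_cond R n) (p : nat)
    (y : R[i] -> 'I_n -> R -> R[i]) (rho : R[i]) : 'M[R[i]]_n :=
  \matrix_(i < n, k < n)
    stack (fun j : 'I_n => rho ^- j *: Ubc B j (zsol p y rho k)) i 0.

Definition beta (R : realType) (n : nat) (B : bdry_cond R n) (p : nat)
    (y : R[i] -> 'I_n -> R -> R[i]) (rho : R[i]) (t : 'I_n) : 'cV[R[i]]_n :=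
  if (t < p)%N then
    stack (fun j : 'I_n =>
      (rho ^- j * cexp (- ('i%C * rho * root_unity R n t)))
      *: U1 B j (y rho t))
  else stack (fun j : 'I_n => rho ^- j *: U0 B j (y rho t)).

Definition characteristic_matrix (R : realType) (n : nat) (B : bdry_cond R n)
    (k p : nat) (y : R[i] -> 'I_n -> R -> R[i]) (A : R[i] -> 'M[R[i]]_n) :
    Prop :=
  exists r0 : R, forall rho : R[i], sector n k rho -> r0 <= normc rho ->
    \det (Delta B p y rho) != 0 ->
    forall t : 'I_n,
      Delta B p y rho *m col t (A rho) =
      (if (t < p)%N then root_unity R n t / (2 * pi)%:C
       else - (root_unity R n t / (2 * pi)%:C)) *: beta B p y rho t.

(* [lam] is a sequence in [T], tending to infinity, along which the resolvent
   exists and is O(1/|lam|) in norm. *)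
Definition resolvent_sequence (R : realType) (n : nat)
    (pc : 'I_n.-1 -> R -> R[i]) (B : bdry_cond R n) (T : set R[i])
    (lam : nat -> R[i]) : Prop :=
  [/\ forall m, T (lam m),
      normc (lam m) @[m --> \oo] --> +oo &
      exists C : R, forall m, in_resolvent_set pc B (lam m) /\
        (resolvent_norm pc B (lam m) <= (C * (normc (lam m))^-1)%:E)%E].

Definition limit_relations (R : realType) (n : nat) (B : bdry_cond R n)
    (p : nat) (y : R[i] -> 'I_n -> R -> R[i]) (A : R[i] -> 'M[R[i]]_n)
    (lam : nat -> R[i]) : Prop :=
  let Th01 := Theta p (bc_b0 B) (bc_b1 B) in
  let Th10 := Theta p (bc_b1 B) (bc_b0 B) in
  exists Dinf Ainf : 'M[R[i]]_n,
  [/\ (Delta B p y (rho_of n (lam m)) : 'M[R[i]^o]_n) @[m --> \oo]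
        --> (Dinf : 'M[R[i]^o]_n),
      Dinf = Th01,
      Th01 \in unitmx,
      (A (rho_of n (lam m)) : 'M[R[i]^o]_n) @[m --> \oo]
        --> (Ainf : 'M[R[i]^o]_n) &
      Ainf = invmx Th01 *m Th10 *m Dmx R n p] /\
  [/\ Dinf != 0, Th01 != 0, Th10 != 0, Dmx R n p != 0 & Ainf != 0].

(* Main.v *)
Require Import Defs.
From HB Require Import structures.
From mathcomp Require Import all_boot all_order all_algebra.
From mathcomp Require Import all_classical all_reals all_analysis.
From mathcomp Require Import complex ring lra measurable_realfun.
Import Order.TTheory GRing.Theory Num.Theory.
Import numFieldNormedType.Exports.
Import ComplexField.Normc.
Local Open Scope classical_set_scope.
Local Open Scope ring_scope.
Local Open Scope complex_scope.

(* The limit of Delta is read off the asymptotics of the solutions; the point is that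
   Theta = Theta_p(b^0, b^1) is invertible. If Theta a = 0 with a <> 0, the function
   sum_k a_k z_k(., rho) solves l(y) = lambda y and, after scaling by rho^-j, satisfies the
   boundary conditions up to o(1). Subtracting a combination, with coefficients o(1), of the
   solutions z_0(., c rho), z_(n-1)(., c rho) for n values of c > 1 gives w in the domain of L
   with |(L - lambda) w| = o(|lambda| |rho|^(-1/2)), whereas |w| >= const |rho|^(-1/2). This
   contradicts |(L - lambda)^-1| = O(1/|lambda|). Correcting by solutions of l(y) = mu y,
   rather than by cut-off functions, keeps l(w) in L^2 although the p_k are only in L^1. *)

(** * Modulus and exponential of complex numbers *)

Section ComplexModulus.
Local Set Implicit Arguments.
Local Unset Strict Implicit.
Context {R : realType}.
Implicit Types z w : R[i].

(** The corrections absorb any boundary data for the following reason. In the limit z_0(., c rho)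
    contributes (c eps_0)^j b_j^0 to the block of order j, and z_(n-1)(., c rho) contributes (c
    eps_(n-1))^j b_j^1. Letting c take n values separates the orders by a Vandermonde determinant,
    and the rank condition on (b_j^0 b_j^1) makes the resulting columns span. Multiplying rho by c >
    0 keeps its argument, hence the sector and the fundamental system, and turns lambda into c^n
    lambda; thus only the corrections contribute to (L - lambda) w. The power |rho|^(-1/2) is the
    L^2 size of a boundary layer of width 1/|rho|: the angular distance eps from the real axis gives
    |Im(rho eps_j)| >= sin(eps/n) |rho| for every j. The obstacle in the lower bound for |w| is
    cancellation between the exponentials. Sampled at n points with spacing 1/(2|rho|) they become
    geometric sequences with uniformly separated ratios, so some sample is bounded below, and with
    it a whole interval of length of order 1/|rho|. *)

Lemma normC_normc z : `|z| = (normc z)%:C. Proof. by []. Qed.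

Lemma normc_ge0 z : 0 <= normc z.
Proof. by rewrite -(ler0c (_ : R)) -normC_normc. Qed.

Lemma normcD_le z w : normc (z + w) <= normc z + normc w.
Proof. by rewrite -lecR rmorphD /= -!normC_normc ler_normD. Qed.

Lemma normc_opp z : normc (- z) = normc z.
Proof. by apply: complexI; rewrite -!normC_normc normrN. Qed.

Lemma normcB_le z w : normc (z - w) <= normc z + normc w.
Proof. by rewrite (le_trans (normcD_le _ _)) // normc_opp. Qed.

Lemma normc_distC z w : normc (z - w) = normc (w - z).
Proof. by rewrite -normc_opp opprB. Qed.

Lemma normcB_ge z w : normc z - normc w <= normc (z - w).
Proof. by rewrite lerBlDr -{1}(subrK w z) normcD_le. Qed.

Lemma normc_expn z k : normc (z ^+ k) = normc z ^+ k.
Proof. by apply: complexI; rewrite -normC_normc normrX normC_normc rmorphXn. Qed.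

Lemma normc_real (x : R) : normc x%:C = `|x|.
Proof. by rewrite /= expr0n /= addr0 sqrtr_sqr. Qed.

Lemma normc_eq0 z : (normc z == 0) = (z == 0).
Proof. by apply/eqP/eqP => [/eq0_normc //|->]; rewrite normc0. Qed.

Lemma normc_gt0 z : (0 < normc z) = (z != 0).
Proof. by rewrite lt_neqAle normc_ge0 eq_sym normc_eq0 andbT. Qed.

Lemma normc_sum (I : finType) (F : I -> R[i]) :
  normc (\sum_i F i) <= \sum_i normc (F i).
Proof.
elim/big_ind2: _ => [|x1 x2 y1 y2 h1 h2|//]; first by rewrite normc0.
exact: le_trans (normcD_le _ _) (lerD h1 h2).
Qed.

Lemma normc_Re_le z : `|complex.Re z| <= normc z.
Proof. by rewrite -lecR -normC_normc normc_ge_Re. Qed.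

Lemma normc_ReIm z : normc z = Num.sqrt (complex.Re z ^+ 2 + complex.Im z ^+ 2).
Proof. by case: z. Qed.

Lemma normc_Im_le z : `|complex.Im z| <= normc z.
Proof. by rewrite normc_ReIm -sqrtr_sqr ler_wsqrtr // lerDr sqr_ge0. Qed.

Lemma normc_le_ReIm z : normc z <= `|complex.Re z| + `|complex.Im z|.
Proof.
rewrite normc_ReIm -[leRHS]ger0_norm ?addr_ge0 // -sqrtr_sqr ler_wsqrtr //.
by rewrite sqrrD !real_normK ?num_real // lerD2r lerDl mulrn_wge0 ?mulr_ge0.
Qed.

Lemma cexpD z w : cexp (z + w) = cexp z * cexp w.
Proof.
case: z w => [a b] [c d]; rewrite /cexp /= expRD cosD sinD.
by apply/eqP; rewrite eq_complex /=; apply/andP; split; apply/eqP; ring.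
Qed.

Lemma cexp0 : cexp 0 = 1 :> R[i].
Proof. by rewrite /cexp /= expR0 cos0 sin0 mul1r. Qed.

Lemma cexpMn z k : cexp (z *+ k) = cexp z ^+ k.
Proof. by elim: k => [|k IH]; rewrite ?mulr0n ?cexp0 // mulrS cexpD IH exprS. Qed.

Lemma normc_cexp z : normc (cexp z) = expR (complex.Re z).
Proof.
rewrite /cexp normcM normc_real ger0_norm ?expR_ge0 //.
by rewrite normc_ReIm /= cos2Dsin2 sqrtr1 mulr1.
Qed.

Lemma cexp_neq0 z : cexp z != 0.
Proof. by rewrite -normc_gt0 normc_cexp expR_gt0. Qed.

Lemma cexpN z : cexp (- z) = (cexp z)^-1.
Proof. by apply: (mulfI (cexp_neq0 z)); rewrite -cexpD subrr cexp0 divff ?cexp_neq0. Qed.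

Lemma cexpB z w : cexp (z - w) = cexp z / cexp w.
Proof. by rewrite cexpD cexpN. Qed.

Lemma sin_norm_ge (y : R) : `|y| <= 1 -> cos 1 * `|y| <= `|sin y|.
Proof.
wlog y0 : y / 0 <= y => [hw|].
  have [y0|/ltW y0] := leP 0 y; first exact: hw.
  by rewrite -normrN -[`|sin y|]normrN -sinN; apply: hw; rewrite oppr_ge0.
rewrite (ger0_norm y0) => y1.
have [|x xy] := @MVT_segment R sin cos 0 y y0 _ _.
  exact/continuous_subspaceT/continuous_sin.
rewrite sin0 !subr0 => ->; apply: le_trans (ler_norm _); apply: ler_wpM2r => //.
move: xy; rewrite in_itv /= => /andP[x0 xy].

(* The cosine decreases on [0, pi], and this interval contains 1. *)
have := pi_ge2 R; have : x <= 1 by exact: le_trans y1.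
rewrite le_eqVlt => /orP[/eqP-> // | x1 pi2].
by rewrite ltW // ltr_cos ?in_itv /=; lra.
Qed.

Lemma sin_norm_le (y : R) : `|sin y| <= `|y|.
Proof.
wlog y0 : y / 0 <= y => [hw|].
  have [y0|/ltW y0] := leP 0 y; first exact: hw.
  by rewrite -normrN -[leRHS]normrN -sinN; apply: hw; rewrite oppr_ge0.
have [|x xy] := @MVT_segment R sin cos 0 y y0 _ _.
  exact/continuous_subspaceT/continuous_sin.
by rewrite sin0 !subr0 => ->; rewrite normrM ler_piMl // cos_max.
Qed.

Lemma cosB1_norm_le (y : R) : `|cos y - 1| <= `|y|.
Proof.
wlog y0 : y / 0 <= y => [hw|].
  have [y0|/ltW y0] := leP 0 y; first exact: hw.
  by rewrite -[leRHS]normrN -cosN; apply: hw; rewrite oppr_ge0.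
have [|x xy] := @MVT_segment R cos (fun x => - sin x) 0 y y0 _ _.
  exact/continuous_subspaceT/continuous_cos.
by rewrite cos0 !subr0 => ->; rewrite normrM ler_piMl // normrN sin_max.
Qed.

Lemma expRB1_norm_le (x : R) : `|x| <= 1 -> `|expR x - 1| <= expR 1 * `|x|.
Proof.
have e1 := expR_ge1Dx (1 : R).
have [x0|x0] := leP 0 x => [x1|_]; rewrite ?(ger0_norm x0) ?(ltr0_norm x0).
  rewrite ger0_norm; last by have := expR_ge1Dx x; lra.
  have h := expR_ge1Dx (- x); have e0 := expR_gt0 x; have ee := expRxMexpNx_1 x.
  apply: (@le_trans _ _ (expR x * x)); first by nra.
  by rewrite ler_wpM2r // ler_expR (le_trans (ler_norm x)).
have h := expR_ge1Dx x; have h1 : expR x <= 1 by rewrite -expR0 ler_expR ltW.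
by rewrite ler0_norm ?subr_le0 //; nra.
Qed.

Lemma expRB1_norm_ge (x : R) : `|x| <= 1 -> expR (-1) * `|x| <= `|expR x - 1|.
Proof.
have [x0|x0] := leP 0 x; rewrite ?(ger0_norm x0) ?(ltr0_norm x0) => x1.
  apply: le_trans (ler_norm _); apply: (@le_trans _ _ x).
    by rewrite ler_piMl // -expR0 ler_expR; lra.
  by have := expR_ge1Dx x; lra.
rewrite -normrN; apply: le_trans (ler_norm _); rewrite opprB.
have h := expR_ge1Dx (- x); have e0 := expR_gt0 x; have ee := expRxMexpNx_1 x.
apply: (@le_trans _ _ (expR x * - x)); last by nra.
by rewrite ler_wpM2r ?ler_expR //; lra.
Qed.

Lemma cexpB1_le z : normc z <= 1 -> normc (cexp z - 1) <= 3 * expR 1 * normc z.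
Proof.
case: z => x y z1; have hx := normc_Re_le (x +i* y); have hy := normc_Im_le (x +i* y).
set N := normc (x +i* y) in z1 hx hy *; rewrite /= in hx hy.
have x1 : `|x| <= 1 by apply: le_trans hx _.
have ex : expR x <= expR 1 by rewrite ler_expR (le_trans (ler_norm _)).
apply: le_trans (normc_le_ReIm _) _; rewrite /cexp /= !mul0r subr0 addr0.
have -> : expR x * cos y - 1 = expR x * (cos y - 1) + (expR x - 1) by ring.
have h1 : `|expR x * (cos y - 1)| <= expR 1 * N.
  rewrite normrM ger0_norm ?expR_ge0 // ler_pM ?expR_ge0 //.
  exact: le_trans (cosB1_norm_le y) _.
have h2 : `|expR x * sin y| <= expR 1 * N.
  rewrite normrM ger0_norm ?expR_ge0 // ler_pM ?expR_ge0 //.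
  exact: le_trans (sin_norm_le y) _.
have h3 : `|expR x - 1| <= expR 1 * N.
  by apply: le_trans (expRB1_norm_le x1) _; rewrite ler_pM2l ?expR_gt0.
rewrite subr0; have := ler_normD (expR x * (cos y - 1)) (expR x - 1); lra.
Qed.

(** The larger of |x| and |y| is at least half of |z|. If it is |x|, the moduli of exp(z) and 1
    already differ enough; otherwise the imaginary part exp(x) sin(y) does. The factors exp(-1) and
    cos 1 are the losses from the real exponential and from the sine on the unit disc. *)
Lemma cexpB1_ge z : normc z <= 1 ->
  cos 1 * expR (-1) / 2 * normc z <= normc (cexp z - 1).
Proof.
case: z => x y z1; have hx := normc_Re_le (x +i* y); have hy := normc_Im_le (x +i* y).
have hxy := normc_le_ReIm (x +i* y).
have N0 := normc_ge0 (x +i* y).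
set N := normc (x +i* y) in z1 hx hy hxy N0 *; rewrite /= in hx hy hxy.
have x1 : `|x| <= 1 by apply: le_trans hx _.
have y1 : `|y| <= 1 by apply: le_trans hy _.
have c0 := @cos1_gt0 R; have c1 := cos_le1 (1 : R); have e0 := expR_gt0 (-1 : R).
have [yx|/ltW xy] := leP `|y| `|x|.
  have : `|expR x - 1| <= normc (cexp (x +i* y) - 1).
    have := normcB_ge (cexp (x +i* y)) 1; have := normcB_ge 1 (cexp (x +i* y)).
    rewrite normc_distC normc1 normc_cexp /= => h1 h2.
    by rewrite ler_norml; apply/andP; split; lra.
  apply: le_trans; apply: le_trans (expRB1_norm_ge x1).
  have -> : cos 1 * expR (-1) / 2 * N = expR (-1) * (cos 1 * (N / 2)) by ring.
  by rewrite ler_pM2l //; nra.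
apply: le_trans (normc_Im_le _); rewrite /cexp /= mul0r addr0 subr0 normrM.
rewrite ger0_norm ?expR_ge0 //.
have -> : cos 1 * expR (-1) / 2 * N = expR (-1) * (cos 1 * (N / 2)) by ring.
apply: ler_pM; rewrite ?expR_ge0 ?ler_expR ?mulr_ge0 ?divr_ge0 ?normc_ge0 ?(ltW c0) //.
  by have := ler_norm (- x); rewrite normrN; lra.
apply: le_trans (sin_norm_ge y1); rewrite ler_pM2l //; lra.
Qed.

End ComplexModulus.

(** * Limits of complex sequences and matrices *)

Section ComplexLimits.
Context {R : realType}.
Local Set Implicit Arguments.
Local Unset Strict Implicit.
Implicit Types (u v : nat -> R[i]) (l : R[i]).

(** Hides the alias [R[i]^o], so that limits can be stated for plain [R[i]]-valued sequences. *)
Definition tends u l : Prop := (fun m => u m : R[i]^o) @ \oo --> (l : R[i]^o).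

Lemma tendsP u l : tends u l <-> normc (u m - l) @[m --> \oo] --> (0 : R).
Proof.
split.
  move=> /cvgrPdist_le h; apply/cvgrPdist_le => e e0.
  have /h : 0 < (e%:C : R[i]) by rewrite ltcR.
  apply: filterS => m /=; rewrite normC_normc lecR sub0r normrN.
  by rewrite ger0_norm ?normc_ge0 // normc_distC.
move=> /cvgrPdist_le h; apply/cvgrPdist_le => -[e e'].
rewrite ltcE /= => /andP[/eqP -> e0].
apply: filterS (h e e0) => m; rewrite sub0r normrN ger0_norm ?normc_ge0 //.
by rewrite normc_distC -lecR.
Qed.

Lemma tends_squeeze u l (e : nat -> R) :
  (\forall m \near \oo, normc (u m - l) <= e m) ->
  e m @[m --> \oo] --> (0 : R) -> tends u l.
Proof.
move=> ue e0; apply/tendsP; apply: (@squeeze_cvgr _ _ _ _ (fun=> 0) e) => //.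
  by apply: filterS ue => m h; rewrite normc_ge0.
exact: cvg_cst.
Qed.

Lemma tends_near u v l : (\forall m \near \oo, u m = v m) -> tends v l -> tends u l.
Proof.
move=> uv vl; apply: cvg_trans vl; apply: near_eq_cvg.
by apply: filterS uv => m ->.
Qed.

Lemma tends_cst l : tends (fun=> l) l. Proof. exact: cvg_cst. Qed.

Lemma tendsD u v l l' : tends u l -> tends v l' -> tends (fun m => u m + v m) (l + l').
Proof. exact: cvgD. Qed.

Lemma tendsM u v l l' : tends u l -> tends v l' -> tends (fun m => u m * v m) (l * l').
Proof. exact: cvgM. Qed.

Lemma tendsV u l : l != 0 -> tends u l -> tends (fun m => (u m)^-1) l^-1.
Proof. by move=> l0; apply: cvgV. Qed.

Lemma tendsX u l k : tends u l -> tends (fun m => u m ^+ k) (l ^+ k).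
Proof.
move=> ul; elim: k => [|k IH]; first exact: tends_cst.
under [X in tends X]eq_fun do rewrite exprS; rewrite exprS; exact: tendsM.
Qed.

Lemma tends_sum (I : Type) (r : seq I) (P : pred I) (u : I -> nat -> R[i]) (l : I -> R[i]) :
  (forall i, P i -> tends (u i) (l i)) ->
  tends (fun m => \sum_(i <- r | P i) u i m) (\sum_(i <- r | P i) l i).
Proof.
move=> h; elim: r => [|i r IH].
  by rewrite big_nil; under [X in tends X]eq_fun do rewrite big_nil; exact: tends_cst.
rewrite big_cons; under [X in tends X]eq_fun do rewrite big_cons.
by case: ifP => [Pi|_]; [exact: tendsD (h i Pi) IH | exact: IH].
Qed.

Lemma tends_prod (I : Type) (r : seq I) (P : pred I) (u : I -> nat -> R[i]) (l : I -> R[i]) :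
  (forall i, P i -> tends (u i) (l i)) ->
  tends (fun m => \prod_(i <- r | P i) u i m) (\prod_(i <- r | P i) l i).
Proof.
move=> h; elim: r => [|i r IH].
  by rewrite big_nil; under [X in tends X]eq_fun do rewrite big_nil; exact: tends_cst.
rewrite big_cons; under [X in tends X]eq_fun do rewrite big_cons.
by case: ifP => [Pi|_]; [exact: tendsM (h i Pi) IH | exact: IH].
Qed.

Lemma tends_neq0 u l : l != 0 -> tends u l -> \forall m \near \oo, u m != 0.
Proof.
move=> l0 /tendsP /cvgrPdist_le /(_ (normc l / 2)).
rewrite divr_gt0 ?normc_gt0 // => /(_ isT); apply: filterS => m.
rewrite sub0r normrN ger0_norm ?normc_ge0 // => h; apply/eqP => um0.
move: h; rewrite um0 sub0r normc_opp => h.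
by have := normc_gt0 l; rewrite l0; lra.
Qed.

(** Entrywise convergence lets determinants and adjugates be treated as finite sums and products;
    [mx_tends_cvg] returns to the matrix topology. *)
Definition mx_tends (p q : nat) (U : nat -> 'M[R[i]]_(p, q)) (L : 'M[R[i]]_(p, q)) :=
  forall i j, tends (fun m => U m i j) (L i j).

Lemma mx_tends_cvg p q (U : nat -> 'M[R[i]]_(p, q)) (L : 'M[R[i]]_(p, q)) :
  mx_tends U L -> (fun m => U m : 'M[R[i]^o]_(p, q)) @ \oo --> (L : 'M[R[i]^o]_(p, q)).
Proof.
move=> h A [Q QL QA].
have : \forall m \near \oo, forall i j, Q i j (U m i j).
  by apply: filter_forall => i; apply: filter_forall => j; exact: h (QL i j).
by apply: filterS => m Qm; exact: QA.
Qed.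

Lemma mx_tends_cst p q (L : 'M[R[i]]_(p, q)) : mx_tends (fun=> L) L.
Proof. by move=> i j; exact: tends_cst. Qed.

Lemma mx_tendsM p q r (U : nat -> 'M[R[i]]_(p, q)) (V : nat -> 'M[R[i]]_(q, r)) L L' :
  mx_tends U L -> mx_tends V L' -> mx_tends (fun m => U m *m V m) (L *m L').
Proof.
move=> UL VL i j; rewrite mxE; under [X in tends X]eq_fun do rewrite mxE.
by apply: tends_sum => k _; exact: tendsM.
Qed.

Lemma tends_det p (U : nat -> 'M[R[i]]_p) L :
  mx_tends U L -> tends (fun m => \det (U m)) (\det L).
Proof.
move=> UL; apply: tends_sum => s _; apply: tendsM; first exact: tends_cst.
by apply: tends_prod => k _; exact: UL.
Qed.

Lemma mx_tends_adj p (U : nat -> 'M[R[i]]_p) L :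
  mx_tends U L -> mx_tends (fun m => \adj (U m)) (\adj L).
Proof.
move=> UL i j; rewrite mxE; under [X in tends X]eq_fun do rewrite mxE.
apply: tendsM; first exact: tends_cst.
apply: tends_det => k l; rewrite !mxE; apply: tends_near (UL _ _).
by apply: nearW => m; rewrite !mxE.
Qed.

(** The matrices [U m] may be singular for small m. Once their determinants are nonzero, the inverse
    is the adjugate divided by the determinant, and both converge. *)
Lemma mx_tends_inv p (U : nat -> 'M[R[i]]_p) L : L \in unitmx ->
  mx_tends U L -> mx_tends (fun m => invmx (U m)) (invmx L).
Proof.
move=> Lu UL i j; have dL : \det L != 0 by rewrite -unitfE -unitmxE.
have [tdet tadj] := (tends_det UL, mx_tends_adj UL).
apply: (tends_near (v := fun m => (\det (U m))^-1 * \adj (U m) i j)).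
  apply: filterS (tends_neq0 dL tdet) => m dm.
  by rewrite /invmx unitmxE unitfE dm mxE.
by rewrite /invmx Lu mxE; exact: tendsM (tendsV dL tdet) (tadj i j).
Qed.

Lemma mx_tends_unit p (U : nat -> 'M[R[i]]_p) L : L \in unitmx ->
  mx_tends U L -> \forall m \near \oo, U m \in unitmx.
Proof.
move=> Lu UL; have dL : \det L != 0 by rewrite -unitfE -unitmxE.
by apply: filterS (tends_neq0 dL (tends_det UL)) => m dm; rewrite unitmxE unitfE.
Qed.

End ComplexLimits.

(** * Linearity of the differential expression *)

Section DifferentialExpression.
Context {R : realType}.
Local Set Implicit Arguments.
Local Unset Strict Implicit.
Implicit Types f g : R -> R[i].

(** Every point of [0, 1], endpoints included, is an accumulation point of [0, 1]. This makes the
    limit in [Dop] unique, so that it can be computed. *)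
Lemma within01_proper (x : R) : x \in `[0, 1] -> ProperFilter (within `[0, 1] (x^')).
Proof.
rewrite in_itv /= => /andP[x0 x1]; split; last exact: within_filter.
rewrite /within /= /dnbhs /within /= => /nbhs_ballP[e /= e0 h].
have [x1'|x1'] := ltP x 1.
  apply: (h (x + Num.min (e / 2) (1 - x))).
  - rewrite /ball /= opprD addNKr normrN ger0_norm ?le_min ?subr_ge0 ?x1 ?divr_ge0 ?ltW //.
    by rewrite (@le_lt_trans _ _ (e / 2)) ?ge_min ?lexx //; lra.
  - by rewrite -subr_eq0 addrC addKr gt_eqF // lt_min subr_gt0 x1' divr_gt0.
  - rewrite /= in_itv /=; apply/andP; split.
      by rewrite addr_ge0 // le_min subr_ge0 x1 divr_ge0 ?ltW.
    by rewrite addrC -lerBrDr ge_min lexx orbT.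
apply: (h (x - Num.min (e / 2) x)).
- rewrite /ball /= opprB addrC subrK ger0_norm ?le_min ?x0 ?divr_ge0 ?ltW //.
  by rewrite (@le_lt_trans _ _ (e / 2)) ?ge_min ?lexx //; lra.
- rewrite -subr_eq0 addrC addKr oppr_eq0 gt_eqF // lt_min divr_gt0 //=; lra.
- rewrite /= in_itv /= subr_ge0 ge_min lexx orbT /=.
  have : 0 <= Num.min (e / 2) x by rewrite le_min x0 divr_ge0 ?ltW.
  lra.
Qed.

(** The derivative as a relation: it can be carried through sums without meeting the default value
    of [lim]. *)
Definition has_diff01 f (x : R) (d : R[i]) : Prop :=
  diff_quot f x t @[t --> within `[0, 1] (x^')] --> (d : R[i]^o).

Lemma has_diff01_Dop f x d : x \in `[0, 1] -> has_diff01 f x d ->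
  derivable01 f x /\ Dop f x = - 'i%C * d.
Proof.
move=> x01 fd; have PF := within01_proper x01; split; first by apply/cvg_ex; exists d.
by rewrite /Dop (cvg_lim _ fd).
Qed.

Lemma derivable01_has_diff f x : derivable01 f x -> exists d, has_diff01 f x d.
Proof. by move=> /cvg_ex. Qed.

Lemma has_diff01_ext f g x d : (forall t, t \in `[0, 1] -> f t = g t) ->
  x \in `[0, 1] -> has_diff01 f x d -> has_diff01 g x d.
Proof.
move=> fg x01; apply: cvg_trans; apply: near_eq_cvg.
rewrite near_withinE; apply: nearW => t t01.
by rewrite /diff_quot !fg.
Qed.

Lemma has_diff01_sum (I : finType) (F : I -> R -> R[i]) (c : I -> R[i]) x (d : I -> R[i]) :
  (forall i, has_diff01 (F i) x (d i)) ->
  has_diff01 (fun t => \sum_i c i * F i t) x (\sum_i c i * d i).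
Proof.
move=> Fd; rewrite /has_diff01.
have -> : diff_quot (fun t => \sum_i c i * F i t) x =
    fun t => \sum_i (c i * diff_quot (F i) x t : R[i]^o).
  apply/funext => t; rewrite /diff_quot -sumrB mulr_suml; apply: eq_bigr => i _.
  by rewrite -mulrBr mulrA.
apply: (@cvg_big _ _ +%R) => [|i _]; first exact: add_continuous.
by apply: cvgM; [exact: cvg_cst | exact: Fd].
Qed.

Lemma Dop_ext f g x : (forall t, t \in `[0, 1] -> f t = g t) ->
  x \in `[0, 1] -> derivable01 f x -> derivable01 g x /\ Dop g x = Dop f x.
Proof.
move=> fg x01 /derivable01_has_diff[d fd]; have [_ ->] := has_diff01_Dop x01 fd.
exact: has_diff01_Dop (has_diff01_ext fg x01 fd).
Qed.

Lemma Dop_sum (I : finType) (F : I -> R -> R[i]) (c : I -> R[i]) x :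
  x \in `[0, 1] -> (forall i, derivable01 (F i) x) ->
  derivable01 (fun t => \sum_i c i * F i t) x /\
  Dop (fun t => \sum_i c i * F i t) x = \sum_i c i * Dop (F i) x.
Proof.
move=> x01 dF.
have [d Fd] := choice (fun i => derivable01_has_diff (dF i)).
have [? ->] := has_diff01_Dop x01 (has_diff01_sum (c := c) Fd); split => //.
rewrite mulr_sumr; apply: eq_bigr => i _.
by have [_ ->] := has_diff01_Dop x01 (Fd i); rewrite mulrCA.
Qed.

Lemma abs_cont01_ext f g : (forall t, t \in `[0, 1] -> f t = g t) ->
  abs_cont01 f -> abs_cont01 g.
Proof.
move=> fg af e /af[d d0 h]; exists d => // N a b ab tr /(h _ _ _ ab tr).
congr (_ < _); apply: eq_bigr => i _; have [/andP[a0 aLb] b1] := ab i.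
by rewrite !fg // in_itv /= ?a0 ?b1 ?andbT /=; [exact: le_trans b1|exact: le_trans aLb].
Qed.

Lemma abs_cont01_scale_add (c : R[i]) f g : abs_cont01 f -> abs_cont01 g ->
  abs_cont01 (fun x => c * f x + g x).
Proof.
move=> af ag e e0; have c0 : 0 < normc c + 1 by have := normc_ge0 c; lra.
have [d1 d10 h1] := af (e / 2 / (normc c + 1)) (divr_gt0 (divr_gt0 e0 (ltr0Sn R 1)) c0).
have [d2 d20 h2] := ag (e / 2) (divr_gt0 e0 (ltr0Sn R 1)).
exists (Num.min d1 d2) => [|N a b ab tr]; first by rewrite lt_min d10.
rewrite lt_min => /andP[/(h1 _ _ _ ab tr) {}h1 /(h2 _ _ _ ab tr) {}h2].
apply: (@le_lt_trans _ _ ((normc c + 1) * (\sum_i normc (f (b i) - f (a i))) +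
   \sum_i normc (g (b i) - g (a i)))).
  rewrite mulr_sumr -big_split /=; apply: ler_sum => i _.
  rewrite (_ : _ - _ = c * (f (b i) - f (a i)) + (g (b i) - g (a i))); last by ring.
  apply: le_trans (normcD_le _ _) _; rewrite lerD2r normcM ler_wpM2r ?normc_ge0 //.
  by rewrite lerDl.
by move: h1; rewrite ltr_pdivlMr // mulrC; lra.
Qed.

Lemma abs_cont01_sum (I : finType) (F : I -> R -> R[i]) (c : I -> R[i]) :
  (forall i, abs_cont01 (F i)) -> abs_cont01 (fun t => \sum_i c i * F i t).
Proof.
move=> aF; elim: (index_enum I) => [|i r IH].
  apply: (abs_cont01_ext (f := fun=> 0)) => [t _|]; first by rewrite big_nil.
  move=> e e0; exists 1 => // N a b _ _ _.
  by rewrite big1 // => i _; rewrite subrr normc0.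
apply: abs_cont01_ext (abs_cont01_scale_add (c i) (aF i) IH) => t _.
by rewrite big_cons.
Qed.

Section Regular.
Context (n : nat) (I : finType) (F : I -> R -> R[i]) (c : I -> R[i]).
Context (n0 : (0 < n)%N) (rF : forall i, regular n (F i)).

(** Induction on k. The previous identity holds on all of [0, 1], which is enough to equate
    derivatives taken within [0, 1], one-sided ones included. *)
Lemma Dn_sum k x : (k < n)%N -> x \in `[0, 1] ->
  Dn k (fun t => \sum_i c i * F i t) x = \sum_i c i * Dn k (F i) x.
Proof.
elim: k x => [//|k IH] x kn x01; rewrite /Dn iterS.
have kn' : (k < n.-1)%N by rewrite ltn_predRL.
have [ds <-] := Dop_sum c x01 (fun i => (rF i).1 k kn' x x01).
have h t : t \in `[0, 1] -> \sum_i c i * Dn k (F i) t = Dn k (fun t => \sum_i c i * F i t) t.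
  by move=> t01; rewrite IH // ltnW.
by have [_] := Dop_ext h x01 ds.
Qed.

Lemma regular_sum : regular n (fun t => \sum_i c i * F i t).
Proof.
have h k : (k < n)%N -> forall t, t \in `[0, 1] ->
    \sum_i c i * Dn k (F i) t = Dn k (fun t => \sum_i c i * F i t) t.
  by move=> kn t t01; rewrite Dn_sum.
split=> k kn.
  move=> x x01; have [ds _] := Dop_sum c x01 (fun i => (rF i).1 k kn x x01).
  by have [] := Dop_ext (h k (leq_trans kn (leq_pred _))) x01 ds.
by apply: abs_cont01_ext (h k kn) (abs_cont01_sum c _) => i; exact: (rF i).2.
Qed.

End Regular.

Lemma ae01_forall (I : finType) (P : I -> R -> Prop) :
  (forall i, ae01 (P i)) -> ae01 (fun x => forall i, P i x).
Proof.
move=> h; have FF := ae_filter_ringOfSetsType (@lebesgue_measure R).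
rewrite /ae01; have : {ae (@lebesgue_measure R), forall x i, x \in `[0, 1] -> P i x}.
  by apply: filter_forall => i; exact: h.
by apply: filterS => x hx x01 i; exact: hx.
Qed.

Lemma l_eq_sum (n : nat) (pc : 'I_n.-1 -> R -> R[i]) (I : finType)
    (F G : I -> R -> R[i]) (c : I -> R[i]) : (0 < n)%N ->
  (forall i, l_eq pc (F i) (G i)) ->
  l_eq pc (fun t => \sum_i c i * F i t) (fun t => \sum_i c i * G i t).
Proof.
move=> n0 lF; have FF := ae_filter_ringOfSetsType (@lebesgue_measure R).
have rF i := (lF i).1; split; first exact: regular_sum.
have : ae01 (fun x => forall i, derivable01 (Dn n.-1 (F i)) x /\ l_expr pc (F i) x = G i x).
  by apply: ae01_forall => i; exact: (lF i).2.
rewrite /ae01; apply: filterS => x h x01; have {}h := h x01.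
have n1 : (n.-1 < n)%N by rewrite prednK.
have [ds Ds] := Dop_sum c x01 (fun i => (h i).1).
(* The derivative of order n exists only almost everywhere, but the one of order n - 1 is linear at
   every point of [0, 1]; differentiating this identity at a good x is legitimate. *)
have hn t : t \in `[0, 1] -> \sum_i c i * Dn n.-1 (F i) t =
    Dn n.-1 (fun t => \sum_i c i * F i t) t by move=> t01; rewrite (@Dn_sum n).
have [ds' Ds'] := Dop_ext hn x01 ds; split => //.
have DnS f : Dn n f x = Dop (Dn n.-1 f) x by rewrite -[in LHS](prednK n0).
rewrite /l_expr DnS Ds' Ds.
under [X in _ + X]eq_bigr => k _.
  rewrite (@Dn_sum n) //; last by rewrite (leq_trans (ltn_ord k)) ?leq_pred.
  rewrite mulr_sumr; over.
rewrite exchange_big -big_split /=; apply: eq_bigr => i _.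
rewrite -(h i).2 /l_expr DnS mulrDr mulr_sumr; congr (_ + _).
by apply: eq_bigr => k _; rewrite mulrCA.
Qed.

(** Absolute continuity is applied to a single interval. The purpose is the measurability of
    solutions. *)
Lemma abs_cont01_continuous f : abs_cont01 f ->
  {within `[0, 1], continuous (fun x => complex.Re (f x))} /\
  {within `[0, 1], continuous (fun x => complex.Im (f x))}.
Proof.
move=> af.
have cf : forall e, 0 < e -> exists2 d, 0 < d & forall s t, s \in `[0, 1] -> t \in `[0, 1] ->
    `|s - t| < d -> normc (f s - f t) < e.
  move=> e /af[d d0 h]; exists d => // s t.
  wlog st : s t / s <= t => [hw s01 t01 st|].
    have [/hw|/ltW /hw] := leP s t; first exact.
    by rewrite normc_distC distrC; exact.
  rewrite !in_itv /= => /andP[s0 s1] /andP[t0 t1] std.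
  have := h 1%N (fun=> s) (fun=> t); rewrite !big_ord1 normc_distC; apply.
  - by move=> _; rewrite s0 st t1.
  - by move=> i j _ _ _; rewrite (ord1 i) (ord1 j).
  - by rewrite -[_ - _]ger0_norm ?subr_ge0 // distrC.
have hc (P : R[i] -> R) : (forall z w, `|P z - P w| <= normc (z - w)) ->
    {within `[0, 1], continuous (fun x => P (f x))}.
  move=> hP; apply/subspace_continuousP => x x01; apply/cvgrPdist_lt => e /cf[d d0 h].
  rewrite near_withinE; apply: filterS (nbhsx_ballx x d d0) => t xt t01.
  exact: le_lt_trans (hP _ _) (h _ _ x01 t01 xt).
split; apply: hc => z w.
  have -> : complex.Re z - complex.Re w = complex.Re (z - w) by case: z w => [? ?] [? ?].
  exact: normc_Re_le.
have -> : complex.Im z - complex.Im w = complex.Im (z - w) by case: z w => [? ?] [? ?].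
exact: normc_Im_le.
Qed.

End DifferentialExpression.

(** * Bounds for the norm of L^2(0, 1) *)

Section SquareIntegrable.
Context {R : realType}.
Local Set Implicit Arguments.
Local Unset Strict Implicit.
Implicit Types f : R -> R[i].
Local Notation mu := (@lebesgue_measure R).

Definition measurable01 f : Prop :=
  @measurable_fun _ _ R R `[0, 1] (fun x => complex.Re (f x)) /\
  @measurable_fun _ _ R R `[0, 1] (fun x => complex.Im (f x)).

Lemma abs_cont01_measurable f : abs_cont01 f -> measurable01 f.
Proof.
move=> /abs_cont01_continuous[cr ci]; have m01 : measurable (`[0, 1]%classic : set R) by [].
by split; apply: subspace_continuous_measurable_fun.
Qed.

Lemma normc_sqr (z : R[i]) : normc z ^+ 2 = complex.Re z ^+ 2 + complex.Im z ^+ 2.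
Proof. by rewrite normc_ReIm sqr_sqrtr // addr_ge0 ?sqr_ge0. Qed.

Lemma measurable01_normc_sqr f : measurable01 f ->
  measurable_fun (`[0, 1]%classic : set R) (fun x => (normc (f x) ^+ 2)%:E).
Proof.
move=> [mr mi].
have -> : (fun x => (normc (f x) ^+ 2)%:E) =
    EFin \o (fun x => complex.Re (f x) ^+ 2 + complex.Im (f x) ^+ 2).
  by apply/funext => x /=; rewrite normc_sqr.
apply/measurable_EFinP.
by apply: measurable_funD; exact: measurable_funX.
Qed.

Lemma L2normE f : L2norm f = ((\int[mu]_(x in `[0%R, 1%R]) (normc (f x) ^+ 2)%:E) `^ 2^-1%R)%E.
Proof.
rewrite /L2norm unlock /= [in RHS]integral_mkcond; congr (_ `^ _)%E.
apply: eq_integral => x _; rewrite /patch; case: ifPn => _ /=.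
  by rewrite ger0_norm ?normc_ge0 // powR_mulrn ?normc_ge0.
by rewrite normr0 powR0.
Qed.

(** The explicit primitive [F] gives the value 2 (1 - exp(-a)) / a. *)
Lemma integral_exp_layers (a : R) : 0 < a ->
  (\int[mu]_(x in `[0%R, 1%R]) (expR (- a * x) + expR (- a * (1 - x)))%:E <= (2 / a)%:E)%E.
Proof.
move=> a0; pose F x := (expR (- a * (1 - x)) - expR (- a * x)) / a.
have dF (x : R) : is_derive x 1 F (expR (- a * x) + expR (- a * (1 - x))).
  apply: is_derive_eq; rewrite /GRing.scale /=.
  by field; rewrite gt_eqF.
have cF : continuous F by move=> x; apply: differentiable_continuous; apply/derivable1_diffP.
rewrite (@continuous_FTC2 _ _ F) //; first last.
- by move=> x _; rewrite derive1E; have [_ ->] := dF x.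
- split => [x _ //||]; [exact: cvg_at_right_filter (cF _)|exact: cvg_at_left_filter (cF _)].
- apply: continuous_subspaceT => x; apply: differentiable_continuous; apply/derivable1_diffP.
  by [].
rewrite -EFinB lee_fin /F subrr subr0 !mulr1 mulr0 expR0.
rewrite -mulrBl ler_pM2r ?invr_gt0 //; have := expR_gt0 (- a); lra.
Qed.

(** A function concentrated in layers of width 1/a at the two endpoints has L^2 norm of order
    a^(-1/2); with a proportional to |rho| this is the source of |rho|^(-1/2). *)
Lemma L2norm_layers f (K a : R) : measurable01 f -> 0 <= K -> 0 < a ->
  (forall x, x \in `[0, 1] -> normc (f x) <= K * (expR (- a * x) + expR (- a * (1 - x)))) ->
  (L2norm f <= (K * Num.sqrt (2 / a))%:E)%E.
Proof.
move=> mf K0 a0 fK; rewrite L2normE; have a20 : 0 < 2 * a by rewrite mulr_gt0.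
pose h (x : R) := expR (- (2 * a) * x) + expR (- (2 * a) * (1 - x)).
have h0 x : 0 <= h x by rewrite addr_ge0 ?expR_ge0.
have mh : measurable_fun (`[0, 1]%classic : set R) (EFin \o h).
  apply/measurable_EFinP; apply: measurable_funD;
    apply: measurableT_comp => //; apply: measurable_funM => //.
  by apply: measurable_funB.
have mn := measurable01_normc_sqr mf.
have K20 : 0 <= 2 * K ^+ 2 by rewrite mulr_ge0 ?sqr_ge0.
have le : (\int[mu]_(x in `[0%R, 1%R]) (normc (f x) ^+ 2)%:E <=
           (2 * K ^+ 2 * (2 / (2 * a)))%:E)%E.
  apply: (@le_trans _ _ (\int[mu]_(x in `[0%R, 1%R]) ((2 * K ^+ 2)%:E * (EFin \o h) x))%E).
    apply: ge0_le_integral => //.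
    - by move=> x _; rewrite lee_fin sqr_ge0.
    - exact: measurable_funeM.
    move=> x /= /fK fx; rewrite -EFinM lee_fin /h.
    have e2 (y : R) : expR (- (2 * a) * y) = expR (- a * y) ^+ 2.
      by rewrite -expRM_natl; congr expR; ring.
    rewrite !e2; set p := expR (- a * x) in fx *; set q := expR (- a * (1 - x)) in fx *.
    apply: (@le_trans _ _ ((K * (p + q)) ^+ 2)).
      by rewrite ler_pXn2r ?nnegrE ?normc_ge0 // mulr_ge0 // addr_ge0 ?expR_ge0.
    (* This is (p + q)^2 <= 2 (p^2 + q^2), which removes the cross term and leaves layers with rate
       2a. *)
    have : 0 <= K ^+ 2 * (p - q) ^+ 2 by rewrite mulr_ge0 ?sqr_ge0.
    lra.
  rewrite ge0_integralZl_EFin //; last by move=> x _; rewrite lee_fin h0.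
  by rewrite [leRHS]EFinM lee_wpmul2l ?lee_fin //; exact: integral_exp_layers.
apply: (@le_trans _ _ ((2 * K ^+ 2 * (2 / (2 * a)))%:E `^ 2^-1%R)%E).
  apply: gt0_ler_poweR => //; rewrite ?in_itv /= ?leey ?andbT ?lee_fin.
  - by apply: integral_ge0 => x _; rewrite lee_fin sqr_ge0.
  - by rewrite mulr_ge0 // divr_ge0 // ltW.
rewrite poweR_EFin powR12_sqrt; last by rewrite mulr_ge0 // divr_ge0 // ltW.
rewrite lee_fin (_ : 2 * K ^+ 2 * (2 / (2 * a)) = K ^+ 2 * (2 / a)); last first.
  by field; rewrite gt_eqF.
by rewrite sqrtrM ?sqr_ge0 // sqrtr_sqr ger0_norm.
Qed.

Lemma L2norm_ge f (c u v : R) : measurable01 f -> 0 <= c -> 0 <= u -> u <= v -> v <= 1 ->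
  (forall x, x \in `[u, v] -> c <= normc (f x)) ->
  ((c * Num.sqrt (v - u))%:E <= L2norm f)%E.
Proof.
move=> mf c0 u0 uv v1 cf; rewrite L2normE; have mn := measurable01_normc_sqr mf.
have uv01 : `[u, v]%classic `<=` (`[0, 1]%classic : set R).
  by move=> x /=; rewrite !in_itv /= => /andP[ux xv]; rewrite (le_trans u0 ux) (le_trans xv).
have le : ((c ^+ 2 * (v - u))%:E <= \int[mu]_(x in `[0%R, 1%R]) (normc (f x) ^+ 2)%:E)%E.
  apply: (@le_trans _ _ (\int[mu]_(x in `[u, v]) (normc (f x) ^+ 2)%:E)%E); last first.
    apply: ge0_subset_integral => //= x _; first by rewrite lee_fin sqr_ge0.
  apply: (@le_trans _ _ (\int[mu]_(x in `[u, v]) cst (c ^+ 2)%:E x)%E).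
    rewrite integral_cst //= lebesgue_measure_itv /= lte_fin.
    case: ltP => uv'; first by rewrite -EFinB -EFinM.
    by rewrite mule0 lee_fin (_ : v - u = 0) ?mulr0 //; apply/eqP; rewrite subr_eq0 eq_le uv'.
  apply: ge0_le_integral => //=.
  - by move=> x _; rewrite lee_fin sqr_ge0.
  - exact: measurable_funS mn.
  by move=> x /cf cx; rewrite lee_fin ler_pXn2r ?nnegrE ?normc_ge0.
apply: (@le_trans _ _ ((c ^+ 2 * (v - u))%:E `^ 2^-1%R)%E).
  rewrite poweR_EFin powR12_sqrt; last by rewrite mulr_ge0 ?sqr_ge0 // subr_ge0.
  by rewrite sqrtrM ?sqr_ge0 // sqrtr_sqr ger0_norm.
apply: gt0_ler_poweR => //; rewrite ?in_itv /= ?leey ?andbT ?lee_fin //.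
- by rewrite mulr_ge0 ?sqr_ge0 // subr_ge0.
- by apply: integral_ge0 => x _; rewrite lee_fin sqr_ge0.
Qed.

End SquareIntegrable.

(** * Boundary conditions *)

Section BoundaryForms.
Context {R : realType} {n : nat}.
Local Set Implicit Arguments.
Local Unset Strict Implicit.
Implicit Types (B : bdry_cond R n) (f : R -> R[i]).

Lemma Dn_scale f (a : R[i]) k x : (0 < n)%N -> regular n f -> (k < n)%N -> x \in `[0, 1] ->
  Dn k (fun t => a * f t) x = a * Dn k f x.
Proof.
move=> n0 rf kn x01.
have := @Dn_sum R n 'I_1 (fun=> f) (fun=> a) (fun=> rf) k x kn x01.
rewrite big_ord1 => <-; congr (Dn k _ x).
by apply/funext => t; rewrite big_ord1.
Qed.

Lemma l_eq_scale (pc : 'I_n.-1 -> R -> R[i]) f g (a : R[i]) : (0 < n)%N ->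
  l_eq pc f g -> l_eq pc (fun t => a * f t) (fun t => a * g t).
Proof.
move=> n0 lf.
have := @l_eq_sum R n pc 'I_1 (fun=> f) (fun=> g) (fun=> a) n0 (fun=> lf).
by congr l_eq; apply/funext => t; rewrite big_ord1.
Qed.

Lemma in01_0 : (0 : R) \in `[0, 1]. Proof. by rewrite in_itv /= lexx ler01. Qed.
Lemma in01_1 : (1 : R) \in `[0, 1]. Proof. by rewrite in_itv /= lexx ler01. Qed.

Lemma U1_scale B j f (a : R[i]) : (0 < n)%N -> regular n f ->
  U1 B j (fun t => a * f t) = a *: U1 B j f.
Proof.
move=> n0 rf; rewrite /U1 scalerDr scaler_sumr Dn_scale ?in01_1 // scalerA.
congr (_ + _); apply: eq_bigr => k _.
by rewrite Dn_scale ?in01_1 // scalerA.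
Qed.

Lemma Ubc_sum B j (I : finType) (F : I -> R -> R[i]) (c : I -> R[i]) : (0 < n)%N ->
  (forall i, regular n (F i)) ->
  Ubc B j (fun t => \sum_i c i * F i t) = \sum_i c i *: Ubc B j (F i).
Proof.
move=> n0 rF; rewrite /Ubc /U0 /U1.
have aux (b : 'cV[R[i]]_(bc_r B j)) (d : 'I_n -> 'cV[R[i]]_(bc_r B j)) x : x \in `[0, 1] ->
    Dn j (fun t => \sum_i c i * F i t) x *: b +
      \sum_(k < n | (k < j)%N) Dn k (fun t => \sum_i c i * F i t) x *: d k =
    \sum_i c i *: (Dn j (F i) x *: b + \sum_(k < n | (k < j)%N) Dn k (F i) x *: d k).
  move=> x01; under [RHS]eq_bigr => i _ do rewrite scalerDr scaler_sumr scalerA.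
  rewrite big_split /= (@Dn_sum R n) // scaler_suml; congr (_ + _).
  rewrite exchange_big; apply: eq_bigr => k _.
  rewrite (@Dn_sum R n) // scaler_suml; apply: eq_bigr => i _; by rewrite scalerA.
rewrite !aux ?in01_0 ?in01_1 // -big_split /=.
by apply: eq_bigr => i _; rewrite !scalerDr.
Qed.

(** The block and the position inside it depend on the row only, not on the stacked family, so an
    entrywise limit reduces to one boundary form of one order. *)
Lemma stack_entry B i : exists j (l : 'I_(bc_r B j)), forall v, stack v i 0 = v j l 0.
Proof.
set i' := cast_ord (esym (bc_r_sum B)) i.
exists (tagnat.sig1 i'), (tagnat.sig2 i') => v.
by rewrite /stack castmxE mxE; congr (v _ _ _); rewrite [LHS]ord1.
Qed.

Lemma stack_eq0 B (v : forall j, 'cV[R[i]]_(bc_r B j)) :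
  stack v = 0 -> forall j, v j = 0.
Proof.
rewrite /stack => /(canRL (castmxK _ _)) h j.
rewrite -[v j](@mxcolK _ _ (bc_r B)) h; apply/matrixP => a b.
by rewrite !mxE castmxE !mxE.
Qed.

Lemma mulmx_castl (p q : nat) (e : p = q) (v : 'rV[R[i]]_q) (w : 'cV[R[i]]_p) :
  v *m castmx (e, erefl 1%N) w = castmx (erefl 1%N, esym e) v *m w.
Proof. by case: _ / e v => v; rewrite !castmx_id. Qed.

(** A linear form on stacked vectors splits into one form per order j and vanishes as soon as all
    its blocks do. *)
Lemma stack_mulmx B (v : 'rV[R[i]]_n) :
  exists2 vv : forall j, 'rV[R[i]]_(bc_r B j),
    (forall u : forall j, 'cV[R[i]]_(bc_r B j), v *m stack u = \sum_j vv j *m u j) &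
    ((forall j, vv j = 0) -> v = 0).
Proof.
set v' := castmx (erefl 1%N, esym (bc_r_sum B)) v.
exists (submxrow v') => [u|h].
  by rewrite /stack mulmx_castl -/v' -[v' in LHS]submxrowK mul_mxrow_mxcol.
have v'0 : v' = 0 by apply/mxrowP => j; rewrite h; apply/matrixP => a b; rewrite !mxE.
have := castmxKV (erefl 1%N) (bc_r_sum B) v; rewrite -[castmx (esym _, _) v]/v' v'0 => <-.
by apply/matrixP => a b; rewrite castmxE !mxE.
Qed.

(** A polynomial with n coefficients and n distinct roots is zero. *)
Lemma vandermonde_coef_eq0 (x q : 'I_n -> R[i]) : injective x ->
  (forall s, \sum_j q j * x s ^+ j = 0) -> forall j, q j = 0.
Proof.
move=> xI qx j; set V := Vandermonde n (\row_s x s).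
have Vu : V \in unitmx.
  rewrite unitmxE det_Vandermonde unitfE; apply/prodf_neq0 => i _.
  apply/prodf_neq0 => k ik; rewrite !mxE subr_eq0; apply/eqP => /xI ki.
  by rewrite ki ltnn in ik.
have : (\row_j q j) *m V = 0.
  apply/matrixP => a s; rewrite !mxE -[RHS](qx s); apply: eq_bigr => k _.
  by rewrite !mxE.
move=> /(congr1 (mulmx^~ (invmx V))); rewrite mulmxK // mul0mx.
by move=> /matrixP/(_ 0 j); rewrite !mxE.
Qed.

(** The exponential in z_k is 1 at one endpoint and negligible at the other, so only the leading
    coefficients of the first endpoint survive in the limit. *)
Definition bside B p (k : 'I_n) (j : 'I_n) : 'cV[R[i]]_(bc_r B j) :=
  if (k < p)%N then bc_b0 B j else bc_b1 B j.

(* The limit of the boundary data of z_k(., c rho). *)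
Definition layer_col B p (c : R) (k : 'I_n) : 'cV[R[i]]_n :=
  stack (fun j : 'I_n => (c%:C * root_unity R n k) ^+ j *: bside B p k j).

Lemma root_unity_neq0 k : root_unity R n k != 0.
Proof. exact: cexp_neq0. Qed.

(** A row vector with blocks vv_j that kills all columns gives two polynomials in c eps_k, with
    coefficients vv_j b_j^0 for k0 and vv_j b_j^1 for k1. Each has the n roots obtained from c = 2,
    ..., n + 1, so all coefficients vanish, and the rank condition yields vv_j = 0. *)
Lemma layers_row_free B p (k0 k1 : 'I_n) : (k0 < p)%N -> (p <= k1)%N ->
  row_free (\matrix_(i < n, l < n + n)
    match fintype.split l with
    | inl s => layer_col B p s.+2%:R k0 i 0
    | inr s => layer_col B p s.+2%:R k1 i 0
    end).
Proof.
move=> k0p pk1; apply: inj_row_free => v; set W := \matrix_(_, _) _ => vW0.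
have [vv vvE] := stack_mulmx B v; apply => j.
have key (k : 'I_n) : (forall s : 'I_n, v *m layer_col B p s.+2%:R k = 0) ->
    vv j *m bside B p k j = 0.
  move=> vk; apply/matrixP => a b; rewrite (ord1 a) (ord1 b) [RHS]mxE.
  pose x (s : 'I_n) : R[i] := (s.+2%:R : R)%:C * root_unity R n k.
  have xI : injective x.
    move=> s t /(mulIf (root_unity_neq0 k)) /complexI /eqP.
    by rewrite eqr_nat => /eqP [] /val_inj.
  apply: (vandermonde_coef_eq0 (q := fun j => (vv j *m bside B p k j) 0 0) xI _ j) => s.
  have := vk s; rewrite /layer_col vvE => /matrixP/(_ 0 0); rewrite summxE [RHS]mxE.
  apply: etrans.
  by apply: eq_bigr => i _; rewrite -scalemxAr [RHS]mxE mulrC.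
have colW (l : 'I_(n + n)) : v *m col l W = 0.
  by rewrite colE mulmxA vW0 mul0mx.
have h0 : vv j *m bc_b0 B j = 0.
  have := key k0; rewrite /bside k0p; apply => s; rewrite -[RHS](colW (lshift n s)).
  by congr (_ *m _); apply/matrixP => a b; rewrite !mxE (unsplitK (inl s)) (ord1 b).
have h1 : vv j *m bc_b1 B j = 0.
  have := key k1; rewrite /bside ltnNge pk1; apply => s; rewrite -[RHS](colW (rshift n s)).
  by congr (_ *m _); apply/matrixP => a b; rewrite !mxE (unsplitK (inr s)) (ord1 b).
have rf : row_free (row_mx (bc_b0 B j) (bc_b1 B j)) by rewrite -row_leq_rank bc_rank.
by apply: (row_free_inj rf); rewrite mul_mx_row h0 h1 mul0mx row_mx0.
Qed.

End BoundaryForms.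

(** * Asymptotics of the boundary data *)

(** [fundamental_system] with its two constants as parameters, so that the lemmas below can share
    them. *)
Definition solutions_asymptotic (R : realType) (n : nat) (pc : 'I_n.-1 -> R -> R[i])
    (kap : nat) (y : R[i] -> 'I_n -> R -> R[i]) (r0 M : R) : Prop :=
  forall sigma, sector n kap sigma -> r0 <= normc sigma ->
  [/\ forall j, l_eq pc (y sigma j) (fun x => sigma ^+ n * y sigma j x),
      forall c : 'I_n -> R[i],
        (forall x : R, x \in `[0, 1] -> \sum_j c j * y sigma j x = 0) ->
        forall j, c j = 0 &
      forall (j m : 'I_n) (x : R), x \in `[0, 1] ->
        exists2 h : R[i], normc h <= M / normc sigma &
          Dn m (y sigma j) x =
          (sigma * root_unity R n j) ^+ m
          * cexp ('i%C * sigma * root_unity R n j * x%:C) * (1 + h)].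

(** What the asymptotic analysis needs from the points lambda_m: all exponentials grow or decay at a
    rate proportional to |rho|, and dilations stay in the sector. In this form both half-planes are
    handled together. *)
Definition dichotomous_sequence (R : realType) (n kap p : nat) (c0 : R)
    (rho : nat -> R[i]) : Prop :=
  [/\ 0 < c0,
      forall m c, 0 < c -> sector n kap (c%:C * rho m),
      normc (rho m) @[m --> \oo] --> +oo &
      forall m (j : 'I_n),
        if (j < p)%N then c0 * normc (rho m) <= complex.Im (rho m * root_unity R n j)
        else complex.Im (rho m * root_unity R n j) <= - (c0 * normc (rho m))].

(* The endpoint where z_k concentrates. *)
Definition edge (R : realType) (n p : nat) (k : 'I_n) : R := (p <= k)%:R.

(** The leading term of [zsol]: for k >= p the division by the exponential at 1 moves the base point
    from 0 to 1. *)
Definition layer (R : realType) (n p : nat) (sigma : R[i]) (k : 'I_n) (x : R) : R[i] :=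
  cexp ('i%C * sigma * root_unity R n k * (x - edge R n p k)%:C).

Arguments edge R {n} p k.
Arguments layer {R n} p sigma k x.

Section Asymptotics.
Context {R : realType} {n : nat} {pc : 'I_n.-1 -> R -> R[i]} {kap p : nat}
  {y : R[i] -> 'I_n -> R -> R[i]} {r0 M c0 : R} {rho : nat -> R[i]}.
Local Set Implicit Arguments.
Local Unset Strict Implicit.
Implicit Types (B : bdry_cond R n) (k j : 'I_n) (c x : R) (sigma : R[i]).

Context (n0 : (0 < n)%N) (ysol : solutions_asymptotic R n pc kap y r0 M)
  (rhoP : dichotomous_sequence R n kap p c0 rho).

Lemma complex1 : 1%:C = 1 :> R[i]. Proof. by []. Qed.

Lemma normc_root_unity (k : nat) : normc (root_unity R n k) = 1.
Proof. by rewrite normc_cexp /= expR0. Qed.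

Lemma layer_edge sigma k : layer p sigma k (edge R p k) = 1.
Proof. by rewrite /layer subrr mulr0 cexp0. Qed.

Lemma rho_neq0 m : rho m != 0.
Proof.
have [_ /(_ m 1 ltr01) [+ _] _ _] := rhoP; by rewrite mul1r.
Qed.

Lemma normc_scale_rho m c : 0 <= c -> normc (c%:C * rho m) = c * normc (rho m).
Proof. by move=> c_ge0; rewrite normcM normc_real ger0_norm. Qed.

(** The sign of Im(rho eps_k) and the sign of x minus the edge agree in both cases, so the layer
    decays away from its edge whichever endpoint that is. *)
Lemma normc_layer m c k x : 0 <= c -> x \in `[0, 1] ->
  normc (layer p (c%:C * rho m) k x) <= expR (- (c0 * c * normc (rho m)) * `|x - edge R p k|).
Proof.
move=> c_ge0 x01; have /andP[x0 x1] : 0 <= x <= 1 by rewrite in_itv in x01.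
rewrite /layer normc_cexp ler_expR.
have -> : complex.Re ('i%C * (c%:C * rho m) * root_unity R n k * (x - edge R p k)%:C) =
    - (c * complex.Im (rho m * root_unity R n k)) * (x - edge R p k).
  case: (rho m) (root_unity R n k) => [a b] [d e] /=; ring.
have [_ _ _ /(_ m k)] := rhoP; rewrite /edge [(p <= k)%N]leqNgt; case: ifPn => kp h /=.
  rewrite subr0 ger0_norm // !mulNr lerN2 ler_wpM2r //.
  by rewrite mulrAC mulrC ler_wpM2l.
rewrite ler0_norm ?subr_le0 // opprB (_ : - (_ * _) * (x - 1) =
  c * complex.Im (rho m * root_unity R n k) * (1 - x)); last by ring.
by rewrite ler_wpM2r ?subr_ge0 //; have := ler_wpM2l c_ge0 h; lra.
Qed.

Lemma zsolE sigma k : zsol p y sigma k =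
  fun x => (if (k < p)%N then 1 else (cexp ('i%C * sigma * root_unity R n k))^-1) * y sigma k x.
Proof.
by apply/funext => x; rewrite /zsol; case: ifP => _; rewrite ?mul1r // mulrC.
Qed.

Lemma zsol_l_eq sigma k : sector n kap sigma -> r0 <= normc sigma ->
  l_eq pc (zsol p y sigma k) (fun x => sigma ^+ n * zsol p y sigma k x).
Proof.
move=> ss rs; have [ly _ _] := ysol ss rs; rewrite zsolE.
have := l_eq_scale (if (k < p)%N then 1 else (cexp ('i%C * sigma * root_unity R n k))^-1) n0 (ly k).
by congr l_eq; apply/funext => x; rewrite mulrCA.
Qed.

Lemma zsol_asymptotic sigma k j x : sector n kap sigma -> r0 <= normc sigma ->
  x \in `[0, 1] -> exists2 h : R[i], normc h <= M / normc sigma &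
  Dn j (zsol p y sigma k) x = (sigma * root_unity R n k) ^+ j * layer p sigma k x * (1 + h).
Proof.
move=> ss rs x01; have [ly _ /(_ k j x x01) [h hM yE]] := ysol ss rs; exists h => //.
rewrite zsolE (@Dn_scale R n) //; last by have [] := ly k.
rewrite yE /layer /edge [(p <= k)%N]leqNgt; case: ifPn => kp; rewrite ?kp /=.
  by rewrite subr0 mul1r.
rewrite rmorphB /= mulrBr mulr1 cexpB; field; exact: cexp_neq0.
Qed.

Lemma normc_rho_inv_tends0 (K : R) : K / normc (rho m) @[m --> \oo] --> 0.
Proof.
have [_ _ rinf _] := rhoP; rewrite -[0](mulr0 K); apply: cvgM; first exact: cvg_cst.
by apply/gtr0_cvgV0 => //; apply: nearW => m; rewrite normc_gt0 rho_neq0.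
Qed.

Lemma near_rho_ge (K : R) : \forall m \near \oo, K <= normc (rho m).
Proof. by have [_ _ rinf _] := rhoP; move/cvgryPge: rinf; exact. Qed.

Lemma near_sector c : 1 <= c -> \forall m \near \oo,
  sector n kap (c%:C * rho m) /\ r0 <= normc (c%:C * rho m).
Proof.
move=> c1; apply: filterS (near_rho_ge r0) => m rm; split.
  by have [_ h _ _] := rhoP; apply: h; exact: lt_le_trans c1.
rewrite normc_scale_rho ?(le_trans _ c1) //; apply: le_trans rm _.
by rewrite ler_peMl ?normc_ge0.
Qed.

(** The value at the opposite endpoint is exponentially small; exp(t) >= 1 + t weakens this to 1/(c0
    |rho|), the same order as the other errors. *)
Lemma layer_endpoint m c k x : 1 <= c -> x = 0 \/ x = 1 ->
  normc (layer p (c%:C * rho m) k x - (x == edge R p k)%:R) <= c0^-1 / normc (rho m).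
Proof.
move=> c1 x01; have [c00 _ _ _] := rhoP; have c_ge0 : 0 <= c by lra.
have r_gt0 : 0 < normc (rho m) by rewrite normc_gt0 rho_neq0.
case: eqP => [->|/eqP xk].
  by rewrite layer_edge subrr normc0 mulr_ge0 ?invr_ge0 ?normc_ge0 // ltW.
rewrite subr0; have xi : x \in `[0, 1] by case: x01 => ->; rewrite ?in01_0 ?in01_1.
apply: le_trans (normc_layer _ _ c_ge0 xi) _.
have -> : `|x - edge R p k| = 1.
  move: xk; rewrite /edge; case: x01 => ->; case: (p <= k)%N => /=;
    by rewrite ?eqxx ?sub0r ?subr0 ?normrN ?normr1.
rewrite mulr1 expRN -invfM lef_pV2 ?posrE ?expR_gt0 ?mulr_gt0 //.
apply: (@le_trans _ _ (c0 * c * normc (rho m))).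
  by rewrite ler_pM2r // ler_peMr // ltW.
by have := expR_ge1Dx (c0 * c * normc (rho m)); lra.
Qed.

Lemma normc_layer_le1 m c k x : 0 <= c -> x \in `[0, 1] ->
  normc (layer p (c%:C * rho m) k x) <= 1.
Proof.
move=> c_ge0 x01; apply: le_trans (normc_layer _ _ c_ge0 x01) _.
have [c00 _ _ _] := rhoP.
by rewrite -expR0 ler_expR mulNr oppr_le0 !mulr_ge0 ?normc_ge0 // ltW.
Qed.

Lemma zsol_boundary_tends c k j x : 1 <= c -> x = 0 \/ x = 1 ->
  tends (fun m => rho m ^- j * Dn j (zsol p y (c%:C * rho m) k) x)
        ((c%:C * root_unity R n k) ^+ j * (x == edge R p k)%:R).
Proof.
move=> c1 x01; have c_ge0 : 0 <= c by lra.
have xi : x \in `[0, 1] by case: x01 => ->; rewrite ?in01_0 ?in01_1.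
apply: tends_squeeze (normc_rho_inv_tends0 (c ^+ j * (c0^-1 + `|M|))).
apply: filterS (near_sector c1) => m [ss rs].
have [h hM ->] := zsol_asymptotic k j ss rs xi; set E := layer p _ _ _.
have r_gt0 : 0 < normc (rho m) by rewrite normc_gt0 rho_neq0.
have -> : rho m ^- j * ((c%:C * rho m * root_unity R n k) ^+ j * E * (1 + h)) -
    (c%:C * root_unity R n k) ^+ j * (x == edge R p k)%:R =
    (c%:C * root_unity R n k) ^+ j * ((E - (x == edge R p k)%:R) + E * h).
  by rewrite !exprMn; field; rewrite expf_neq0 ?rho_neq0.
rewrite normcM normc_expn normcM normc_root_unity mulr1 normc_real ger0_norm //.
rewrite -mulrA; apply: ler_wpM2l; first exact: exprn_ge0.
apply: le_trans (normcD_le _ _) _; rewrite mulrDl; apply: lerD.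
  exact: layer_endpoint.
rewrite normcM -[leRHS]mul1r; apply: ler_pM; rewrite ?normc_ge0 ?normc_layer_le1 //.
apply: (le_trans hM); apply: (@le_trans _ _ (`|M| / normc (c%:C * rho m))).
  by rewrite ler_wpM2r ?invr_ge0 ?normc_ge0 ?ler_norm.
rewrite ler_wpM2l // normc_scale_rho // lef_pV2 ?posrE // ?mulr_gt0 //; last lra.
by rewrite ler_peMl // ltW.
Qed.

(** After scaling by rho^-j a term of order k < j is rho^-(j-k) times a convergent quantity and
    tends to 0. The endpoint and the coefficients are kept arbitrary to serve both halves of
    [Ubc]. *)
Lemma boundary_form_tends B j (f : nat -> R -> R[i]) x (d : 'I_n -> R[i])
    (b : 'cV[R[i]]_(bc_r B j)) (a : 'I_n -> 'cV[R[i]]_(bc_r B j)) l :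
  (forall j, tends (fun m => rho m ^- j * Dn j (f m) x) (d j)) ->
  tends (fun m => (rho m ^- j *: (Dn j (f m) x *: b +
           \sum_(k < n | (k < j)%N) Dn k (f m) x *: a k)) l 0) (d j * b l 0).
Proof.
(* The limit is padded with the vanishing limits of the lower order terms, so that it matches the
   form term by term. *)
move=> fd; have -> : d j * b l 0 = d j * b l 0 + \sum_(k < n | (k < j)%N) 0 * d k * a k l 0.
  by rewrite [X in _ + X]big1 ?addr0 // => k _; rewrite !mul0r.
pose u m := rho m ^- j * Dn j (f m) x * b l 0 + \sum_(k < n | (k < j)%N)
  rho m ^- (j - k) * (rho m ^- k * Dn k (f m) x) * a k l 0.
apply: (@tends_near _ _ u); last first.
  apply: tendsD; first by apply: tendsM; [exact: fd | exact: tends_cst].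
  apply: tends_sum => k kj; apply: tendsM; last exact: tends_cst.
  apply: tendsM; last exact: fd.
  have rinv : tends (fun m => (rho m)^-1) 0.
    apply: tends_squeeze (normc_rho_inv_tends0 1).
    by apply: nearW => m; rewrite subr0 normcV mul1r.
  have -> : 0 = 0 ^+ (j - k) :> R[i] by rewrite expr0n subn_eq0 leqNgt kj.
  by under [X in tends X]eq_fun do rewrite -exprVn; exact: tendsX.
apply: nearW => m; rewrite /u !mxE mulrDr mulrA; congr (_ + _).
rewrite summxE mulr_sumr; apply: eq_bigr => k kj; rewrite !mxE.
rewrite !mulrA; congr (_ * _ * _).
by rewrite -invfM -exprD subnK // ltnW.
Qed.

(** The scaling is by rho and not by c rho. The factor c^j left in the limit is what later
    distinguishes the orders. *)
Lemma Ubc_zsol_tends B c k i : 1 <= c ->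
  tends (fun m => stack (fun j => rho m ^- j *: Ubc B j (zsol p y (c%:C * rho m) k)) i 0)
        (layer_col B p c k i 0).
Proof.
move=> c1; have [j [l lE]] := stack_entry B i.
rewrite /layer_col lE; under [X in tends X]eq_fun do rewrite lE /Ubc scalerDr mxE.
have b0 := boundary_form_tends (b := bc_b0 B j) (l := l) (bc_c0 B j)
  (fun j => zsol_boundary_tends (k := k) (j := j) c1 (or_introl (erefl 0))).
have b1 := boundary_form_tends (b := bc_b1 B j) (l := l) (bc_c1 B j)
  (fun j => zsol_boundary_tends (k := k) (j := j) c1 (or_intror (erefl 1))).
have := tendsD b0 b1; congr tends; rewrite mxE /bside /edge [(p <= k)%N]leqNgt.
case: (k < p)%N => /=; first by rewrite eqxx oner_eq0 mulr1 mulr0 mul0r addr0.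
by rewrite eqxx eq_sym oner_eq0 mulr1 mulr0 mul0r add0r.
Qed.

Lemma Theta_layer_col B i k : Theta p (bc_b0 B) (bc_b1 B) i k = layer_col B p 1 k i 0.
Proof.
rewrite mxE /layer_col /Bcol /bside; have [j [l lE]] := stack_entry B i.
by case: ifP => _; rewrite [LHS]lE [RHS]lE [LHS]mxE [RHS]mxE complex1 mul1r.
Qed.

Lemma Delta_tends B : mx_tends (fun m => Delta B p y (rho m)) (Theta p (bc_b0 B) (bc_b1 B)).
Proof.
move=> i k; rewrite Theta_layer_col; under [X in tends X]eq_fun do rewrite mxE.
apply: tends_near (Ubc_zsol_tends (B := B) (k := k) (i := i) (lexx 1)).
by apply: nearW => m; rewrite complex1 mul1r.
Qed.

Lemma beta_tends B t i :
  tends (fun m => beta B p y (rho m) t i 0)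
        (Theta p (bc_b1 B) (bc_b0 B) i t).
Proof.
have [j [l lE]] := stack_entry B i.
have sec : \forall m \near \oo, sector n kap (rho m) /\ r0 <= normc (rho m).
  by apply: filterS (near_sector (lexx 1)) => m; rewrite complex1 mul1r.
(* y_t is normalized here at the endpoint opposite to that of z_t. *)
pose a m := if (t < p)%N then cexp (- ('i%C * rho m * root_unity R n t)) else 1.
pose x : R := (t < p)%:R.
have xi : x \in `[0, 1] by rewrite /x; case: (t < p)%N; rewrite ?in01_0 ?in01_1.
have lim k : tends (fun m => rho m ^- k * Dn k (fun s => a m * y (rho m) t s) x)
                  (root_unity R n t ^+ k).
  apply: tends_squeeze (normc_rho_inv_tends0 M).
  apply: filterS sec => m [ss rs]; have [ly _ /(_ t k x xi) [h hM yE]] := ysol ss rs.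
  rewrite (@Dn_scale R n) //; last by have [] := ly t.
  rewrite yE /a /x; case: ifP => _; rewrite ?mulr1 ?mulr0 ?cexp0 ?cexpN.
    rewrite (_ : _ - _ = root_unity R n t ^+ k * h).
      by rewrite normcM normc_expn normc_root_unity expr1n mul1r.
    by rewrite exprMn; field; rewrite cexp_neq0 expf_neq0 ?rho_neq0.
  rewrite (_ : _ - _ = root_unity R n t ^+ k * h).
    by rewrite normcM normc_expn normc_root_unity expr1n mul1r.
  by rewrite exprMn; field; rewrite expf_neq0 ?rho_neq0.
rewrite mxE /Bcol; case: ifPn => tp; rewrite lE mxE.
  have := boundary_form_tends (b := bc_b1 B j) (l := l) (bc_c1 B j) lim.
  apply: tends_near; apply: filterS sec => m [ss rs].
  have [ly _ _] := ysol ss rs.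
  have rt : regular n (y (rho m) t) by have [] := ly t.
  have := U1_scale B j (a m) n0 rt; rewrite /beta tp lE -scalerA /a tp => <-.
  by rewrite /U1 /x tp.
have := boundary_form_tends (b := bc_b0 B j) (l := l) (bc_c0 B j) lim.
apply: tends_near; apply: nearW => m; rewrite /beta (negbTE tp) lE.
rewrite /U0 /x /a (negbTE tp) (_ : (fun s => 1 * _) = y (rho m) t) //.
by apply/funext => s; rewrite mul1r.
Qed.

End Asymptotics.

(** * Lower bound for combinations of exponentials *)

Section Sampling.
Context {R : realType}.
Local Set Implicit Arguments.
Local Unset Strict Implicit.

(* The product of the operators [shift - u], u in [s]: it annihilates the geometric
   sequences with ratio in [s]. *)
Definition diffs (s : seq R[i]) (v : nat -> R[i]) : nat -> R[i] :=
  foldr (fun u w i => w i.+1 - u * w i) v s.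

Lemma diffs_le (s : seq R[i]) (v : nat -> R[i]) (b K : R) j : 0 <= K ->
  (forall u, u \in s -> normc u <= K) ->
  (forall i, (i <= j + size s)%N -> normc (v i) <= b) ->
  normc (diffs s v j) <= (1 + K) ^+ size s * b.
Proof.
move=> K0; elim: s j => [|u s IH] j us vb /=.
  by rewrite mul1r vb // leq_addr.
have us' u' : u' \in s -> normc u' <= K by move=> h; apply: us; rewrite inE h orbT.
have h1 : normc (diffs s v j.+1) <= (1 + K) ^+ size s * b.
  by apply: IH => // i hi; apply: vb; rewrite /= addnS -addSn.
have h0 : normc (diffs s v j) <= (1 + K) ^+ size s * b.
  by apply: IH => // i hi; apply: vb; rewrite (leq_trans hi) //= addnS.
apply: le_trans (normcB_le _ _) _; rewrite exprS -mulrA mulrDl mul1r lerD //.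
by rewrite normcM ler_pM ?normc_ge0 ?us ?inE ?eqxx.
Qed.

Lemma diffs_exp (I : finType) (s : seq R[i]) (a x : I -> R[i]) i :
  diffs s (fun i => \sum_k a k * x k ^+ i) i =
  \sum_k a k * \prod_(u <- s) (x k - u) * x k ^+ i.
Proof.
elim: s i => [|u s IH] i /=; first by under [RHS]eq_bigr do rewrite big_nil mulr1.
rewrite !IH mulr_sumr -sumrB; apply: eq_bigr => k _.
by rewrite big_cons exprS; ring.
Qed.

Lemma normc_prod_ge (s : seq R[i]) (z : R[i]) (d : R) : 0 <= d ->
  (forall u, u \in s -> d <= normc (z - u)) ->
  d ^+ size s <= normc (\prod_(u <- s) (z - u)).
Proof.
move=> d0; elim: s => [|u s IH] h; first by rewrite big_nil normc1.
rewrite big_cons normcM exprS ler_pM ?exprn_ge0 ?h ?inE ?eqxx //.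
by apply: IH => v vs; apply: h; rewrite inE vs orbT.
Qed.

(** A quantitative inversion of a Vandermonde system: the operators shift - x_k with k different
    from k0 annihilate every term but the one of k0, which is multiplied by the product of the
    differences x_k0 - x_k. *)
Lemma sampling_le (n : nat) (a x : 'I_n -> R[i]) (k0 : 'I_n) (b K d : R) :
  0 <= K -> 0 <= d -> (forall k, normc (x k) <= K) ->
  (forall k, k != k0 -> d <= normc (x k0 - x k)) ->
  (forall i, (i < n)%N -> normc (\sum_k a k * x k ^+ i) <= b) ->
  d ^+ n.-1 * normc (a k0) <= (1 + K) ^+ n.-1 * b.
Proof.
move=> K0 d0 xK xd vb.
have n0 : (0 < n)%N := leq_ltn_trans (leq0n _) (ltn_ord k0).
pose s := [seq x k | k <- enum (predC1 k0)].
have ss : size s = n.-1 by rewrite size_map -cardE cardC1 card_ord.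
have sP u : u \in s -> exists2 k, k != k0 & u = x k.
  by move=> /mapP[k]; rewrite mem_enum inE => kk0 ->; exists k.
rewrite -ss; apply: le_trans (diffs_le (v := fun i => \sum_k a k * x k ^+ i) (j := 0) K0 _ _).
- rewrite diffs_exp (bigD1 k0) //= [X in _ + X]big1 ?addr0 => [|k kk0].
    rewrite expr0 mulr1 normcM mulrC ler_wpM2l ?normc_ge0 // normc_prod_ge //.
    by move=> u /sP[k kk0 ->]; exact: xd.
  rewrite (_ : \prod_(u <- s) _ = 0) ?mulr0 ?mul0r //.
  apply/eqP; rewrite prodf_seq_eq0; apply/hasP; exists (x k); last by rewrite subrr /=.
  by apply: map_f; rewrite mem_enum inE.
- by move=> u /sP[k _ ->].
- by move=> i; rewrite ss add0n => hi; apply: vb; rewrite -(prednK n0) ltnS.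
Qed.

Lemma finite_min_gt0 (I : finType) (P : pred I) (f : I -> R) :
  (forall k, P k -> 0 < f k) -> exists2 d, 0 < d & forall k, P k -> d <= f k.
Proof.
move=> f0; exists (\big[Num.min/1]_(k | P k) f k).
  by elim/big_ind: _ => // u v u0 v0; rewrite lt_min u0.
by move=> k Pk; rewrite (bigD1 k) //= ge_min lexx.
Qed.

(** cos(t - s) = 1 forces sin((t - s)/2) = 0, and (t - s)/2 lies in [0, pi) when s <= t. *)
Lemma cexp_angle_inj (s t : R) : 0 <= s < 2 * pi -> 0 <= t < 2 * pi ->
  cexp (s *i) = cexp (t *i) -> s = t.
Proof.
wlog st : s t / s <= t => [hw|].
  have [/hw//|/ltW/hw h ss tt /esym e] := leP s t; exact/esym/h.
move=> /andP[s0 s1] /andP[t0 t1] e.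
have : cexp ((t - s) *i) = 1 :> R[i].
  have -> : (t - s) *i = t *i - s *i :> R[i] by apply/eqP; rewrite eq_complex /= subr0 !eqxx.
  by rewrite cexpB e divff // cexp_neq0.
rewrite /cexp /= expR0 mul1r => -[] ct _.
have h : sin ((t - s) / 2) = 0.
  have := cos2Dsin2 ((t - s) / 2); have := cosD ((t - s) / 2) ((t - s) / 2).
  rewrite -splitr ct => h1 h2; apply/eqP; rewrite -sqrf_eq0; apply/eqP; lra.
apply/eqP; rewrite eq_le st /= leNgt; apply/negP => lt_st.
have : 0 < sin ((t - s) / 2) by apply: sin_gt0_pi; apply/andP; split; lra.
by rewrite h ltxx.
Qed.

Lemma root_unity_inj (n : nat) : injective (fun k : 'I_n => root_unity R n k).
Proof.
move=> j k; have n0 : (0 < n)%N := leq_ltn_trans (leq0n _) (ltn_ord k).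
have ang (i : 'I_n) : 0 <= 2 * @pi R * i%:R / n%:R < 2 * @pi R.
  have p20 : 0 < 2 * @pi R by rewrite mulr_gt0 ?pi_gt0.
  apply/andP; split; first by rewrite divr_ge0 // mulr_ge0 // ltW.
  by rewrite ltr_pdivrMr ?ltr0n // ltr_pM2l // ltr_nat.
move=> /(cexp_angle_inj (ang j) (ang k)) h.
have nn0 : (n%:R : R)^-1 != 0 by rewrite invr_eq0 pnatr_eq0 -lt0n.
have pp0 : 2 * @pi R != 0 by rewrite mulf_neq0 // gt_eqF // pi_gt0.
apply: val_inj; apply/eqP; rewrite -(eqr_nat R); apply/eqP.
exact: (mulfI pp0) (mulIf nn0 h).
Qed.

End Sampling.

(** * Combinations of solutions under the resolvent bound *)

Lemma l_eq_abs_cont (R : realType) (n : nat) (pc : 'I_n.-1 -> R -> R[i]) f g :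
  (0 < n)%N -> l_eq pc f g -> abs_cont01 f.
Proof. by move=> n0 [[_ /(_ 0%N n0)]]. Qed.

Lemma L2norm_scale (R : realType) (f : R -> R[i]) (a : R[i]) : measurable01 f ->
  L2norm (fun x => a * f x) = ((normc a)%:E * L2norm f)%E.
Proof.
move=> mf; have mn := measurable01_normc_sqr mf; rewrite !L2normE.
under eq_integral => x _ do rewrite normcM exprMn EFinM.
rewrite ge0_integralZl_EFin ?sqr_ge0 //; last by move=> x _; rewrite lee_fin sqr_ge0.
rewrite poweRM ?lee_fin ?sqr_ge0 //; last first.
  by apply: integral_ge0 => x _; rewrite lee_fin sqr_ge0.
by rewrite poweR_EFin powR12_sqrt ?sqr_ge0 // sqrtr_sqr ger0_norm ?normc_ge0.
Qed.

Section Resolvent.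
Context {R : realType} {n : nat} {pc : 'I_n.-1 -> R -> R[i]} {B : bdry_cond R n}.
Local Set Implicit Arguments.
Local Unset Strict Implicit.

(** Each F_i solves l(F_i) = mu_i F_i, so (L - lambda) applied to the sum of gam_i F_i multiplies
    its coefficients by mu_i - lambda. The right-hand side is again a combination of bounded
    continuous functions, hence in L^2. *)
Lemma resolvent_norm_le (I : finType) (F : I -> R -> R[i]) (mu gam : I -> R[i])
    (lam : R[i]) (r t K : R) : (0 < n)%N -> 0 < t ->
  (resolvent_norm pc B lam <= r%:E)%E ->
  (forall i, l_eq pc (F i) (fun x => mu i * F i x)) ->
  (forall i x, x \in `[0, 1] -> normc (F i x) <= K) ->
  (forall j, Ubc B j (fun x => \sum_i gam i * F i x) = 0) ->
  (L2norm (fun x => (\sum_i gam i * (mu i - lam) * F i x)%R) <= t%:E)%E ->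
  (L2norm (fun x => (\sum_i gam i * F i x)%R) <= (t * r)%:E)%E.
Proof.
move=> n0 t0 rr lF FK Uw gt; have aF i : abs_cont01 (F i) by exact: l_eq_abs_cont (lF i).
have tC : t%:C != 0 :> R[i] by rewrite -normc_gt0 normc_real normr_gt0 gt_eqF.
have mS (c : I -> R[i]) : measurable01 (fun x => \sum_i c i * F i x).
  exact/abs_cont01_measurable/abs_cont01_sum.
(* The resolvent norm is a supremum over right-hand sides of norm at most 1, hence the division by
   t. *)
pose yt (x : R) := \sum_i (gam i / t%:C) * F i x.
pose g (x : R) := \sum_i (gam i / t%:C) * (mu i * F i x).
have ytE : yt = fun x => t%:C^-1 * \sum_i gam i * F i x.
  by apply/funext => x; rewrite mulr_sumr; apply: eq_bigr => i _; rewrite mulrA [_^-1 * _]mulrC.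
have gE : g = fun x => \sum_i (gam i / t%:C * mu i) * F i x.
  by apply/funext => x; apply: eq_bigr => i _; rewrite mulrA.
have gyE : (fun x => g x - lam * yt x) =
    fun x => t%:C^-1 * \sum_i gam i * (mu i - lam) * F i x.
  apply/funext => x; rewrite /g /yt !mulr_sumr -sumrB; apply: eq_bigr => i _; ring.
have mg : measurable01 g by rewrite gE.
have ytr : (L2norm yt <= r%:E)%E.
  apply: le_trans rr; apply: ereal_sup_ubound; exists yt => //; exists g; last first.
    rewrite gyE (L2norm_scale _ _ _ (mS _)) normcV normc_real gtr0_norm //.
    apply: (@le_trans _ _ ((t^-1)%:E * t%:E)%E).
      by apply: lee_wpmul2l gt; rewrite lee_fin invr_ge0 ltW.
    by rewrite -EFinM mulVf // gt_eqF.
  split; first exact: l_eq_sum.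
  - have [m1 m2] := mg; split=> //.
    pose K' := (\sum_i normc (gam i / t%:C * mu i)) * `|K|.
    (* A function bounded by K' is put into layer form with rate 1, because exp(1) (exp(-x) + exp(x
       - 1)) >= 1 on [0, 1]. *)
    apply: (@le_lt_trans _ _ (K' * expR 1 * Num.sqrt (2 / 1))%:E); last exact: ltry.
    have K'0 : 0 <= K' by rewrite mulr_ge0 // sumr_ge0 // => i _; rewrite normc_ge0.
    apply: L2norm_layers => //; first by rewrite mulr_ge0 ?expR_ge0.
    move=> x x01; apply: (@le_trans _ _ K').
      rewrite gE; apply: le_trans (normc_sum _) _; rewrite /K' mulr_suml; apply: ler_sum => i _.
      rewrite normcM ler_wpM2l ?normc_ge0 // (le_trans (FK i x x01)) //.
      exact: ler_norm.
    rewrite -mulrA ler_peMr // mulrDr -[leLHS]addr0 lerD ?mulr_ge0 ?expR_ge0 //.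
    rewrite -expRD -[leLHS]expR0 ler_expR; move: x01; rewrite in_itv /= => /andP[_ x1]; lra.
  - move=> j; rewrite /yt (Ubc_sum B j _ n0 (fun i => (lF i).1)).
    under eq_bigr => i _ do rewrite mulrC -scalerA.
    by rewrite -scaler_sumr -(Ubc_sum B j _ n0 (fun i => (lF i).1)) Uw scaler0.
rewrite (_ : (fun x => \sum_i gam i * F i x) = fun x => t%:C * yt x); last first.
  by apply/funext => x; rewrite ytE mulVKf.
rewrite (L2norm_scale _ _ _ (mS _)) normc_real gtr0_norm // EFinM.
by apply: lee_wpmul2l ytr; rewrite lee_fin ltW.
Qed.

End Resolvent.

(** * Lower bound for combinations of boundary layers *)

Section LowerBound.
Local Set Implicit Arguments.
Local Unset Strict Implicit.
Context {R : realType} {n kap p : nat} {c0 : R} {rho : nat -> R[i]}.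
Context (rhoP : dichotomous_sequence R n kap p c0 rho).

Lemma layer_shift (sigma : R[i]) (k : 'I_n) (x t : R) :
  layer p sigma k (x + t) =
  layer p sigma k x * cexp ('i%C * sigma * root_unity R n k * t%:C).
Proof.
rewrite /layer -cexpD; congr cexp.
by rewrite addrAC rmorphD mulrDr.
Qed.

Lemma normc_phase (sigma w : R[i]) (t : R) :
  normc ('i%C * sigma * w * t%:C) = normc sigma * normc w * `|t|.
Proof.
have ni : normc ('i%C : R[i]) = 1 by rewrite /= expr0n /= expr1n add0r sqrtr1.
by rewrite normcM normc_real -(mulrA 'i%C sigma w) normcM (normcM sigma w) ni mul1r.
Qed.

(** Sampling starts at the edge of k0, where the layer of k0 equals 1, and moves inwards. A sample
    exceeding a fixed b exists by [sampling_le], and the combination varies by at most b/2 over a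
    distance q/|rho|. *)
Lemma layers_lower_bound (a : 'I_n -> R[i]) (k0 : 'I_n) : a k0 != 0 ->
  exists c1 d1 : R, [/\ 0 < c1, 0 < d1 &
    \forall m \near \oo, exists u v : R,
      [/\ 0 <= u, v <= 1, v - u = d1 / normc (rho m) &
        forall x, x \in `[u, v] -> c1 <= normc (\sum_k a k * layer p (rho m) k x)]].
Proof.
move=> a0; have n0 : (0 < n)%N := leq_ltn_trans (leq0n _) (ltn_ord k0).
have [e e0 eP] : exists2 e : R, 0 < e & forall k, k != k0 ->
    e <= normc (root_unity R n k0 - root_unity R n k).
  apply: (finite_min_gt0 (P := fun k => k != k0)) => k kk0.
  rewrite normc_gt0 subr_eq0; apply/eqP => /root_unity_inj kE.
  by rewrite kE eqxx in kk0.
pose kappa : R := cos 1 * expR (-1) / 2.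
have kappa0 : 0 < kappa by rewrite divr_gt0 // mulr_gt0 ?cos1_gt0 ?expR_gt0.
pose K : R := expR 1.
(* Separation of the ratios: they have modulus at least exp(-1), and the quotient of two of them is
   the exponential of a number of modulus at least e/2, to which [cexpB1_ge] applies. *)
pose d : R := expR (-1) * (kappa * (e / 2)).
have d0 : 0 < d by rewrite mulr_gt0 ?expR_gt0 // mulr_gt0 // divr_gt0.
(* Half of what [sampling_le] guarantees, so that all samples being at most b is contradictory. *)
pose b : R := d ^+ n.-1 * normc (a k0) / (1 + K) ^+ n.-1 / 2.
have K1 : 0 < (1 + K) ^+ n.-1 by rewrite exprn_gt0 // addr_gt0 ?expR_gt0.
have b0 : 0 < b by rewrite !divr_gt0 // mulr_gt0 ?exprn_gt0 ?normc_gt0.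
pose S : R := \sum_k normc (a k).
have S0 : 0 <= S by rewrite sumr_ge0 // => k _; rewrite normc_ge0.
(* The bound 1 keeps the shift in the range of [cexpB1_le]; the other bound limits the variation to
   b/2. *)
pose q : R := Num.min 1 (b / 2 / ((S + 1) * (3 * expR 1))).
have Se0 : 0 < (S + 1) * (3 * expR 1).
  by rewrite mulr_gt0 ?ltr_wpDl // mulr_gt0 ?expR_gt0.
have q0 : 0 < q by rewrite lt_min ltr01 /= divr_gt0 // divr_gt0.
have q1 : q <= 1 by rewrite ge_min lexx.
have qS : S * (3 * expR 1 * q) <= b / 2.
  apply: (@le_trans _ _ ((S + 1) * (3 * expR 1) * q)).
    rewrite mulrA ler_wpM2r ?(ltW q0) // ler_wpM2r ?mulr_ge0 ?expR_ge0 //; lra.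
  by rewrite mulrC -ler_pdivlMr // ge_min lexx orbT.
exists (b / 2), q; split=> //; first lra.
(* This size of |rho| fits the n sampling points and the interval of length q/|rho| into [0, 1]. *)
apply: filterS (near_rho_ge rhoP (n%:R + 1)) => m rm.
have N1 : 1 <= (n%:R : R) by rewrite ler1n.
set N := normc (rho m) in rm *; have N0 : 0 < N by lra.
(* The inward direction: 1 at the endpoint 0 and -1 at the endpoint 1. *)
pose s : R := 1 - 2 * edge R p k0.
have s1 : s = 1 \/ s = -1 by rewrite /s /edge; case: (p <= k0)%N; [right|left] => /=; ring.
have ns : `|s| = 1 by case: s1 => ->; rewrite ?normrN normr1.
pose E (k : 'I_n) (t : R) := cexp ('i%C * rho m * root_unity R n k * (s * t)%:C).
have nE k t : 0 <= t -> normc ('i%C * rho m * root_unity R n k * (s * t)%:C) = N * t.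
  by move=> t0; rewrite normc_phase normc_root_unity mulr1 normrM ns mul1r ger0_norm.
(* Two roots of unity differ by at most 2, so with N h = 1/2 the phase differences have modulus at
   most 1. *)
pose h : R := (2 * N)^-1.
have h0 : 0 <= h by rewrite invr_ge0 mulr_ge0 // ltW.
have Nh : N * h = 2^-1 by rewrite /h; field; rewrite gt_eqF.
have Ele k : normc (E k h) <= K /\ expR (-1) <= normc (E k h).
  have := normc_Re_le ('i%C * rho m * root_unity R n k * (s * h)%:C).
  rewrite nE // Nh ler_norml normc_cexp /K !ler_expR => /andP[? ?]; split; lra.
have [i iP] : exists2 i, (i < n)%N &
    b < normc (\sum_k a k * layer p (rho m) k (edge R p k0 + s * (i%:R * h))).
  apply: contrapT => nex.
  have vb i : (i < n)%N ->
      normc (\sum_k (a k * layer p (rho m) k (edge R p k0)) * E k h ^+ i) <= b.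
    move=> iltn; rewrite leNgt; apply/negP => hi; apply: nex; exists i => //.
    congr (_ < normc _): hi; apply: eq_bigr => k _.
    rewrite layer_shift -mulrA -cexpMn; congr (_ * (_ * cexp _)).
    by rewrite -mulr_natr !rmorphM /= rmorph_nat; ring.
  have xd k : k != k0 -> d <= normc (E k0 h - E k h).
    move=> /eP ek; rewrite (_ : E k0 h - E k h =
        E k h * (cexp ('i%C * rho m * (root_unity R n k0 - root_unity R n k) * (s * h)%:C) - 1)).
      have zE : normc ('i%C * rho m * (root_unity R n k0 - root_unity R n k) * (s * h)%:C) =
          normc (root_unity R n k0 - root_unity R n k) / 2.
        by rewrite normc_phase normrM ns mul1r (ger0_norm h0) mulrAC Nh mulrC.
      have ke0 : 0 <= kappa * (e / 2) by rewrite ltW // mulr_gt0 // divr_gt0.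
      rewrite normcM; apply: ler_pM; rewrite ?expR_ge0 //; first by have [] := Ele k.
      apply: le_trans (cexpB1_ge _); rewrite zE.
        by rewrite ler_pM2l // ler_pM2r.
      have := normcB_le (root_unity R n k0) (root_unity R n k).
      rewrite !normc_root_unity; lra.
    by rewrite mulrBr mulr1 -cexpD; congr (cexp _ - _); ring.
  have := sampling_le (expR_ge0 1) (ltW d0) (fun k => (Ele k).1) xd vb.
  rewrite normcM layer_edge normc1 mulr1 -ler_pdivrMl // mulrC leNgt => /negP; apply.
  rewrite /b; have : 0 < d ^+ n.-1 * normc (a k0) / (1 + K) ^+ n.-1.
    by rewrite divr_gt0 // mulr_gt0 ?exprn_gt0 ?normc_gt0.
  lra.
set x0 := edge R p k0 + _ => bx0.
have near_x0 t : 0 <= t <= q / N -> x0 \in `[0, 1] ->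
    b / 2 <= normc (\sum_k a k * layer p (rho m) k (x0 + s * t)).
  move=> /andP[t0 tq] x001.
  have -> : \sum_k a k * layer p (rho m) k (x0 + s * t) = \sum_k a k * layer p (rho m) k x0
      - \sum_k a k * layer p (rho m) k x0 * (1 - E k t).
    rewrite -sumrB; apply: eq_bigr => k _; rewrite layer_shift /E; ring.
  apply: le_trans (normcB_ge _ _).
  suff : normc (\sum_k a k * layer p (rho m) k x0 * (1 - E k t)) <= b / 2 by lra.
  apply: le_trans qS; apply: le_trans (normc_sum _) _; rewrite mulr_suml.
  apply: ler_sum => k _; rewrite -mulrA (normcM (a k)) ler_wpM2l ?normc_ge0 //.
  rewrite (normcM (layer p _ _ _)).
  have Nt : N * t <= q by rewrite mulrC -ler_pdivlMr.
  rewrite -[leRHS]mul1r ler_pM ?normc_ge0 //.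
    by have := normc_layer_le1 rhoP m k ler01 x001; rewrite complex1 mul1r.
  rewrite normc_distC; apply: le_trans (cexpB1_le _) _; rewrite nE //; first lra.
  by rewrite ler_pM2l // mulr_gt0 ?expR_gt0.
have qN : 0 <= q / N by rewrite divr_ge0 // ltW.
have ihN : 0 <= i%:R * h by rewrite mulr_ge0.
have ihq : i%:R * h + q / N <= 1.
  have -> : i%:R * h + q / N = (i%:R / 2 + q) / N by rewrite /h; field; rewrite gt_eqF.
  rewrite ler_pdivrMr // mul1r; have : (i%:R : R) <= n%:R by rewrite ler_nat ltnW.
  lra.
have xx0 : x0 \in `[0, 1].
  rewrite in_itv /= /x0 /s /edge; case: (p <= k0)%N => /=; apply/andP; split; lra.
case: s1 => s1.
  exists x0, (x0 + q / N); split; last 1 first.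
  - move=> x; rewrite in_itv /= => /andP[x1 x2].
    rewrite (_ : x = x0 + s * (x - x0)); last by rewrite s1; ring.
    by apply: near_x0 => //; apply/andP; split; lra.
  - by move: xx0; rewrite in_itv /= => /andP[].
  - move: s1; rewrite /x0 /s /edge; case: (p <= k0)%N => /= s1; lra.
  - by rewrite addrC addKr.
exists (x0 - q / N), x0; split; last 1 first.
- move=> x; rewrite in_itv /= => /andP[x1 x2].
  rewrite (_ : x = x0 + s * (x0 - x)); last by rewrite s1; ring.
  by apply: near_x0 => //; apply/andP; split; lra.
- move: s1; rewrite /x0 /s /edge; case: (p <= k0)%N => /= s1; lra.
- by move: xx0; rewrite in_itv /= => /andP[].
- by rewrite opprB addrC subrK.
Qed.

End LowerBound.

(** * Invertibility of Theta *)

Section Regularity.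
Context {R : realType} {n : nat} {pc : 'I_n.-1 -> R -> R[i]} {kap p : nat}
  {y : R[i] -> 'I_n -> R -> R[i]} {r0 M c0 : R} {rho : nat -> R[i]}
  {B : bdry_cond R n}.
Local Set Implicit Arguments.
Local Unset Strict Implicit.
Context (ysol : solutions_asymptotic R n pc kap y r0 M)
  (rhoP : dichotomous_sequence R n kap p c0 rho) (p_gt0 : (0 < p)%N) (p_ltn : (p < n)%N).

Let n0 : (0 < n)%N. Proof. exact: leq_ltn_trans p_ltn. Qed.

Let k0 : 'I_n := Ordinal n0.

Let ltn_predn : (n.-1 < n)%N. Proof. by rewrite prednK // n0. Qed.

Let k1 : 'I_n := Ordinal ltn_predn.

(** A pair of a dilation and one of the two solutions is coded by a single index, which then serves
    as the column index of an n by 2n matrix. *)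
Definition corr_scale (l : 'I_(n + n)) : R :=
  match fintype.split l with inl s => s.+2%:R | inr s => s.+2%:R end.

Definition corr_index (l : 'I_(n + n)) : 'I_n :=
  match fintype.split l with inl _ => k0 | inr _ => k1 end.

Lemma corr_scaleP l : 1 <= corr_scale l <= n.+1%:R.
Proof.
by rewrite /corr_scale; case: fintype.split => s; rewrite ler1n ler_nat; exact: (ltn_ord s).
Qed.

Lemma corr_matrix_row_free :
  row_free (\matrix_(i < n, l < n + n) layer_col B p (corr_scale l) (corr_index l) i 0).
Proof.
have pk1 : (p <= k1)%N by rewrite /= -ltnS prednK.
have := layers_row_free B (k0 := k0) p_gt0 pk1; congr (is_true (row_free _)).
by apply/matrixP => i l; rewrite !mxE /corr_scale /corr_index; case: fintype.split.
Qed.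

(** The error is relative to the layer, so z_k inherits the decay that the L^2 estimate uses. *)
Lemma zsol_layer_near (c : R) : 1 <= c -> \forall m \near \oo, forall k x, x \in `[0, 1] ->
  normc (zsol p y (c%:C * rho m) k x - layer p (c%:C * rho m) k x) <=
    `|M| / normc (rho m) * normc (layer p (c%:C * rho m) k x).
Proof.
move=> c1; have := near_sector (r0 := r0) rhoP c1; apply: filterS => m [ss rs] k x x01.
have r_gt0 : 0 < normc (rho m) by rewrite normc_gt0 (rho_neq0 rhoP).
(* Here [k0] is the order of the derivative, that is 0. *)
have [h hM hE] := zsol_asymptotic (p := p) n0 ysol k k0 ss rs x01.
rewrite /= expr0 mul1r in hE; rewrite hE mulrDr mulr1 addrAC subrr add0r normcM mulrC.
rewrite ler_wpM2r ?normc_ge0 //; apply: (le_trans hM).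
rewrite normc_scale_rho ?(le_trans _ c1) // (@le_trans _ _ (`|M| / (c * normc (rho m)))) //.
  by rewrite ler_wpM2r ?invr_ge0 ?mulr_ge0 ?normc_ge0 ?ler_norm // (le_trans _ c1).
rewrite ler_wpM2l // lef_pV2 ?posrE //; first by rewrite ler_peMl // ltW.
by rewrite mulr_gt0 // (lt_le_trans _ c1).
Qed.

Lemma normc_layer_le_layers m (c : R) (k : 'I_n) (x : R) : 1 <= c -> x \in `[0, 1] ->
  normc (layer p (c%:C * rho m) k x) <=
  expR (- (c0 * normc (rho m)) * x) + expR (- (c0 * normc (rho m)) * (1 - x)).
Proof.
move=> c1 x01; have [c00 _ _ _] := rhoP; have c_ge0 : 0 <= c by lra.
apply: le_trans (normc_layer rhoP _ _ c_ge0 x01) _.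
have /andP[x0 x1] : 0 <= x <= 1 by rewrite in_itv in x01.
have N0 : 0 <= c0 * normc (rho m) by rewrite mulr_ge0 ?normc_ge0 // ltW.
have key (t : R) : 0 <= t ->
    expR (- (c0 * c * normc (rho m)) * t) <= expR (- (c0 * normc (rho m)) * t).
  move=> t0; rewrite ler_expR !mulNr lerN2 ler_wpM2r //.
  by rewrite (mulrAC c0) ler_peMr.
rewrite /edge; case: (p <= k)%N => /=.
  by rewrite distrC ger0_norm ?subr_ge0 // (le_trans (key _ _)) ?subr_ge0 // lerDr expR_ge0.
by rewrite subr0 ger0_norm // (le_trans (key _ _)) // lerDl expR_ge0.
Qed.

(* The two families z_0(., c rho) and z_(n-1)(., c rho), c = 2, ..., n + 1, have boundary
   data spanning the whole space in the limit, so they can absorb the boundary data of the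
   quasi-mode. *)
Lemma corrections_tend0 (a : 'cV[R[i]]_n) :
  Theta p (bc_b0 B) (bc_b1 B) *m a = 0 ->
  exists V : nat -> 'cV[R[i]]_(n + n),
    (forall e, 0 < e -> \forall m \near \oo, forall l, normc (V m l 0) <= e) /\
    \forall m \near \oo, forall j,
      \sum_k a k 0 *: Ubc B j (zsol p y (rho m) k) =
      \sum_l V m l 0 *: Ubc B j (zsol p y ((corr_scale l)%:C * rho m) (corr_index l)).
Proof.
move=> Tha; have /row_freeP[W' WW'] := corr_matrix_row_free.
set W := \matrix_(i, l) _ in WW'.
pose Wm m := \matrix_(i < n, l < n + n) stack (fun j : 'I_n =>
  rho m ^- j *: Ubc B j (zsol p y ((corr_scale l)%:C * rho m) (corr_index l))) i 0.
have WmW : mx_tends Wm W.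
  move=> i l; rewrite mxE; under [X in tends X]eq_fun do rewrite mxE.
  by have /andP[c1 _] := corr_scaleP l; exact: (Ubc_zsol_tends n0 ysol rhoP c1).
have WmW' : mx_tends (fun m => Wm m *m W') 1%:M.
  by rewrite -WW'; apply: mx_tendsM => //; exact: mx_tends_cst.
(* W' is a right inverse of the limit matrix only. Correcting it by the inverse of Wm W', which
   tends to 1, gives an exact right inverse of Wm for large m, while Delta a tends to Theta a =
   0. *)
pose V m := W' *m (invmx (Wm m *m W') *m (Delta B p y (rho m) *m a)).
have V0 : mx_tends V 0.
  have -> : 0 = W' *m (invmx 1%:M *m (Theta p (bc_b0 B) (bc_b1 B) *m a)).
    by rewrite Tha !mulmx0.
  apply: mx_tendsM; first exact: mx_tends_cst.
  apply: mx_tendsM; first by apply: mx_tends_inv => //; exact: unitmx1.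
  by apply: mx_tendsM; [exact: (Delta_tends n0 ysol rhoP) | exact: mx_tends_cst].
exists V; split=> [e e0|].
  apply: filter_forall => l; have := V0 l 0.
  rewrite [X in tends _ X]mxE => /tendsP /cvgrPdist_le /(_ e e0).
  by apply: filterS => m; rewrite sub0r normrN subr0 ger0_norm ?normc_ge0.
apply: filterS (mx_tends_unit (unitmx1 _ _) WmW') => m mu j.
have WV : Wm m *m V m = Delta B p y (rho m) *m a by rewrite /V mulmxA mulKVmx.
pose v (j : 'I_n) := rho m ^- j *: (\sum_k a k 0 *: Ubc B j (zsol p y (rho m) k) -
      \sum_l V m l 0 *: Ubc B j (zsol p y ((corr_scale l)%:C * rho m) (corr_index l))).
have v0 : stack v = 0.
  apply/matrixP => i z; rewrite (ord1 z) [RHS]mxE; have [j' [l' lE]] := stack_entry B i.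
  have /matrixP/(_ i 0) := WV; rewrite [LHS]mxE [RHS]mxE => e.
  rewrite lE /v mxE mxE [X in _ * (_ + X)]mxE !summxE mulrDr mulrN !mulr_sumr.
  apply/eqP; rewrite subr_eq0; apply/eqP; transitivity (\sum_k Delta B p y (rho m) i k * a k 0).
    by apply: eq_bigr => k _; rewrite [X in _ = X * _]mxE lE !mxE mulrCA mulrC.
  rewrite -e; apply: eq_bigr => l _.
  by rewrite [X in X * _ = _]mxE lE !mxE mulrCA mulrC.
have /eqP := stack_eq0 v0 j; rewrite /v scaler_eq0 subr_eq0 invr_eq0 expf_eq0.
by rewrite (negbTE (rho_neq0 rhoP m)) andbF => /eqP.
Qed.

Lemma Theta_unitmx (lam : nat -> R[i]) (C : R) :
  (forall m, lam m = rho m ^+ n) ->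
  (forall m, (resolvent_norm pc B (lam m) <= (C * (normc (lam m))^-1)%:E)%E) ->
  Theta p (bc_b0 B) (bc_b1 B) \in unitmx.
Proof.
move=> lamE resC; rewrite unitmxE unitfE -det_tr; apply/negP => /det0P[v v0 vT].
pose a : 'cV[R[i]]_n := v^T.
have Tha : Theta p (bc_b0 B) (bc_b1 B) *m a = 0.
  by apply: trmx_inj; rewrite trmx_mul trmxK vT trmx0.
have [k2 ak2] : exists k, a k 0 != 0.
  apply: contrapT => nex; move/eqP: v0; apply; apply/matrixP => z k; rewrite (ord1 z) [RHS]mxE.
  by apply/eqP; apply: contrapT => /negP vk; apply: nex; exists k; rewrite mxE.
have [c1 [d1 [c10 d10 lower]]] := layers_lower_bound rhoP (a := fun k => a k 0) ak2.
have [V [V0 VU]] := corrections_tend0 Tha.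
have [c00 _ _ _] := rhoP.
pose Sa : R := \sum_k normc (a k 0).
have Sa0 : 0 <= Sa by rewrite sumr_ge0 // => k _; rewrite normc_ge0.
pose nn : R := (n + n)%:R.
have nn0 : 0 < nn by rewrite ltr0n addn_gt0 n0.
(* There are [nn] corrections; each is at most twice its layer, and |mu - lambda| <= (n + 1)^n
   |lambda| since c <= n + 1. *)
pose K1 : R := nn * (2 * n.+1%:R ^+ n).
have K10 : 0 < K1 by apply: mulr_gt0 => //; rewrite mulr_gt0 ?exprn_gt0 ?ltr0n.
(* A positive majorant, as the sign of C is not given. *)
pose C' : R := `|C| + 1.
have C'0 : 0 < C' by rewrite ltr_wpDl.
(* D |rho|^(-1/2) will bound |w| from below, and e G |rho|^(-1/2) from above by the resolvent
   estimate. *)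
pose D : R := c1 / 2 * Num.sqrt d1.
have D0 : 0 < D by apply: mulr_gt0; [exact: divr_gt0 | rewrite sqrtr_gt0].
pose G : R := K1 * C' * (Num.sqrt (2 / c0)).
have G0 : 0 < G.
  by apply: mulr_gt0; [exact: mulr_gt0 | rewrite sqrtr_gt0 divr_gt0].
(* The first bound keeps the corrections pointwise below c1/4, the second makes e G at most D/2. *)
pose e : R := Num.min (c1 / 4 / (2 * nn)) (D / 2 / G).
have e0 : 0 < e.
  rewrite lt_min; apply/andP; split; last by apply: divr_gt0 => //; exact: divr_gt0.
  by apply: divr_gt0; [exact: divr_gt0 | exact: mulr_gt0].
have e1 : nn * (2 * e) <= c1 / 4.
  by rewrite mulrCA mulrA mulrC -ler_pdivlMr ?mulr_gt0 // ge_min lexx.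
have e2 : e * G <= D / 2 by rewrite -ler_pdivlMr // ge_min lexx orbT.
(* The left summand carries the quasi-mode, at scale 1: there mu = lambda, so these terms drop out
   of (L - lambda) w. *)
pose ci (i : 'I_n + 'I_(n + n)) : R := if i is inr l then corr_scale l else 1.
pose ki (i : 'I_n + 'I_(n + n)) : 'I_n := match i with inl k => k | inr l => corr_index l end.
have ci1 i : 1 <= ci i by case: i => [//|l]; have /andP[] := corr_scaleP l.
pose F m i x := zsol p y ((ci i)%:C * rho m) (ki i) x.
pose La m i x := layer p ((ci i)%:C * rho m) (ki i) x.
have lay : \forall m \near \oo, forall i x, x \in `[0, 1] ->
    normc (F m i x - La m i x) <= `|M| / normc (rho m) * normc (La m i x).
  apply: filter_forall => i; have := zsol_layer_near (ci1 i).
  by apply: filterS => m h x; exact: h.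
have sec : \forall m \near \oo, forall i,
    sector n kap ((ci i)%:C * rho m) /\ r0 <= normc ((ci i)%:C * rho m).
  by apply: filter_forall => i; exact: (near_sector rhoP (ci1 i)).
have : \forall m \near \oo, False; last by move=> /filter_ex[].
near=> m.
have Ve : forall l, normc (V m l 0) <= e by near: m; exact: V0.
have N1 : 1 <= normc (rho m) by near: m; exact: near_rho_ge rhoP _.
have NM : `|M| <= normc (rho m) by near: m; exact: near_rho_ge rhoP _.
have NS : 4 * Sa * `|M| / c1 <= normc (rho m) by near: m; exact: near_rho_ge rhoP _.
have laym : forall i x, x \in `[0, 1] ->
    normc (F m i x - La m i x) <= `|M| / normc (rho m) * normc (La m i x) by near: m.
have secm : forall i, sector n kap ((ci i)%:C * rho m) /\
    r0 <= normc ((ci i)%:C * rho m) by near: m.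
have VUm : forall j, \sum_k a k 0 *: Ubc B j (zsol p y (rho m) k) =
    \sum_l V m l 0 *: Ubc B j (zsol p y ((corr_scale l)%:C * rho m) (corr_index l)).
  by near: m.
have [u [v' [u0 v1 vu lowm]]] : exists u v : R,
      [/\ 0 <= u, v <= 1, v - u = d1 / normc (rho m) &
        forall x, x \in `[u, v] -> c1 <= normc (\sum_k a k 0 * layer p (rho m) k x)].
  by near: m.
set N := normc (rho m) in N1 NM NS vu laym *; have N0 : 0 < N by lra.
have MN : `|M| / N <= 1 by rewrite ler_pdivrMr ?mul1r.
have LaK i x : x \in `[0, 1] -> normc (La m i x) <=
    expR (- (c0 * N) * x) + expR (- (c0 * N) * (1 - x)) /\ normc (La m i x) <= 1.
  move=> x01; split; first exact: normc_layer_le_layers.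
  by apply: (normc_layer_le1 rhoP) => //; exact: le_trans (ci1 i).
have FLa i x : x \in `[0, 1] -> normc (F m i x) <= 2 * normc (La m i x).
  move=> x01; rewrite -[F m i x](subrK (La m i x)); apply: le_trans (normcD_le _ _) _.
  have := laym i x x01; have := normc_ge0 (La m i x); nra.
pose gam (i : 'I_n + 'I_(n + n)) := match i with inl k => a k 0 | inr l => - V m l 0 end.
pose mu i := ((ci i)%:C * rho m) ^+ n.
have lF i : l_eq pc (F m i) (fun x => mu i * F m i x).
  by have [ss rs] := secm i; exact: (zsol_l_eq n0 ysol).
have FK i x : x \in `[0, 1] -> normc (F m i x) <= 2.
  by move=> x01; have := FLa i x x01; have [_] := LaK i x x01; lra.
have Uw j : Ubc B j (fun x => \sum_i gam i * F m i x) = 0.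
  rewrite (Ubc_sum B j gam n0 (fun i => (lF i).1)) big_sumType /=.
  under eq_bigr do rewrite /F /= complex1 mul1r.
  by rewrite VUm -big_split big1 //= => l _; rewrite -scalerDl subrr scale0r.
have lam0 : 0 < normc (lam m).
  by rewrite normc_gt0 lamE expf_neq0 // (rho_neq0 rhoP).
have mS (c : 'I_n + 'I_(n + n) -> R[i]) : measurable01 (fun x => \sum_i c i * F m i x).
  by apply/abs_cont01_measurable/abs_cont01_sum => i; exact: l_eq_abs_cont (lF i).
have mulam i : mu i - lam m = (ci i ^+ n - 1)%:C * lam m.
  by rewrite /mu lamE exprMn rmorphB rmorphXn /= mulrBl mul1r.
have gle x : x \in `[0, 1] -> normc (\sum_i gam i * (mu i - lam m) * F m i x) <=
    K1 * e * normc (lam m) * (expR (- (c0 * N) * x) + expR (- (c0 * N) * (1 - x))).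
  move=> x01; set E := expR _ + _; rewrite big_sumType /= big1 ?add0r => [|k _]; last first.
    by rewrite mulam /= expr1n subrr mul0r mulr0 mul0r.
  apply: le_trans (normc_sum _) _.
  apply: (@le_trans _ _ (\sum_(l < n + n) e * (n.+1%:R ^+ n * normc (lam m)) * (2 * E))).
    apply: ler_sum => l _; rewrite normcM; apply: ler_pM; rewrite ?normc_ge0 //.
      rewrite normcM normc_opp; apply: ler_pM; rewrite ?normc_ge0 // mulam normcM.
      rewrite ler_wpM2r ?normc_ge0 // normc_real.
      have /andP[h1 h2] := corr_scaleP l; have h3 := exprn_ege1 n h1.
      rewrite ger0_norm ?subr_ge0 // (@le_trans _ _ (ci (inr l) ^+ n)) //; first by rewrite gerBl.
      by rewrite lerXn2r ?nnegrE // (le_trans ler01).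
    by apply: le_trans (FLa _ _ x01) _; rewrite ler_pM2l //; have [] := LaK (inr l) x x01.
  rewrite sumr_const card_ord le_eqVlt; apply/orP; left; apply/eqP.
  by rewrite -[LHS]mulr_natl -/nn /K1; ring.
pose t := K1 * e * normc (lam m) * Num.sqrt (2 / (c0 * N)).
have t0 : 0 < t.
  apply: mulr_gt0; last by rewrite sqrtr_gt0 divr_gt0 // mulr_gt0.
  by apply: mulr_gt0 => //; exact: mulr_gt0.
have gt : (L2norm (fun x => (\sum_i gam i * (mu i - lam m) * F m i x)%R) <= t%:E)%E.
  have a0 : 0 < c0 * N by exact: mulr_gt0.
  have K0 : 0 <= K1 * e * normc (lam m) by rewrite mulr_ge0 ?normc_ge0 // mulr_ge0 // ltW.
  exact: (L2norm_layers (mS (fun i => gam i * (mu i - lam m))) K0 a0 gle).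
have := resolvent_norm_le n0 t0 (resC m) lF FK Uw gt.
have wge : ((c1 / 2 * Num.sqrt (v' - u))%:E <= L2norm (fun x => (\sum_i gam i * F m i x)%R))%E.
  have uv : u <= v' by rewrite -subr_ge0 vu divr_ge0 // ltW.
  apply: L2norm_ge => // [|x xuv]; first by rewrite divr_ge0 // ltW.
  have x01 : x \in `[0, 1].
    move: xuv; rewrite !in_itv /= => /andP[ux xv].
    by rewrite (le_trans u0 ux) (le_trans xv v1).
  (* The combination of layers has modulus at least c1. Replacing z_k by layers and adding the
     corrections cost at most c1/4 each. *)
  have -> : \sum_i gam i * F m i x = \sum_k a k 0 * layer p (rho m) k x -
     (\sum_k a k 0 * (La m (inl k) x - F m (inl k) x) + \sum_l V m l 0 * F m (inr l) x).
    rewrite big_sumType /= opprD addrA -sumrB -sumrN; congr (_ + _); apply: eq_bigr => i _.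
      by rewrite /La /= complex1 mul1r; ring.
    by rewrite mulNr.
  apply: le_trans (normcB_ge _ _); have := lowm x xuv.
  suff : normc (\sum_k a k 0 * (La m (inl k) x - F m (inl k) x) +
      \sum_l V m l 0 * F m (inr l) x) <= c1 / 2 by lra.
  apply: le_trans (normcD_le _ _) _.
  have h1 : normc (\sum_k a k 0 * (La m (inl k) x - F m (inl k) x)) <= c1 / 4.
    apply: (@le_trans _ _ (Sa * (`|M| / N))).
      apply: le_trans (normc_sum _) _; rewrite mulr_suml; apply: ler_sum => k _.
      rewrite normcM ler_wpM2l ?normc_ge0 // normc_distC; apply: le_trans (laym _ _ x01) _.
      by rewrite ler_piMr ?divr_ge0 ?(ltW N0) //; have [] := LaK (inl k) x x01.
    rewrite mulrA ler_pdivrMr //; move: NS; rewrite ler_pdivrMr //; lra.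
  have h2 : normc (\sum_l V m l 0 * F m (inr l) x) <= nn * (2 * e).
    apply: le_trans (normc_sum _) _.
    apply: (@le_trans _ _ (\sum_(l < n + n) 2 * e)).
      apply: ler_sum => l _; rewrite normcM mulrC; apply: ler_pM; rewrite ?normc_ge0 //.
      exact: FK.
    by rewrite sumr_const card_ord -[leLHS]mulr_natl.
  lra.
(* The powers of |lambda| cancel and both sides carry |rho|^(-1/2); what remains is D <= e G <= D/2,
   impossible for D > 0. *)
move=> /(le_trans wge); rewrite lee_fin vu sqrtrM ?(ltW d10) //.
rewrite /t (_ : 2 / (c0 * N) = 2 / c0 * N^-1); last by rewrite invfM mulrA.
rewrite sqrtrM ?divr_ge0 ?(ltW c00) //; set sN := Num.sqrt N^-1.
have sN0 : 0 < sN by rewrite sqrtr_gt0 invr_gt0.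
have -> : K1 * e * normc (lam m) * (Num.sqrt (2 / c0) * sN) * (C * (normc (lam m))^-1) =
    K1 * C * Num.sqrt (2 / c0) * e * sN by field; rewrite gt_eqF.
rewrite mulrA -/D => DsN.
have : D * sN <= D / 2 * sN.
  apply: (le_trans DsN); rewrite ler_pM2r //; apply: le_trans e2; rewrite [leRHS]mulrC.
  rewrite ler_pM2r // /G ler_wpM2r ?sqrtr_ge0 // ler_pM2l // /C'.
  by rewrite (le_trans (ler_norm C)) // lerDl.
rewrite ler_pM2r //; lra.
Unshelve. all: by end_near.
Qed.

End Regularity.

(** * Sectors *)

Section Sectors.
Context {R : realType}.
Local Set Implicit Arguments.
Local Unset Strict Implicit.
Implicit Types (lam : R[i]) (t : R).

(** The default value of [argc] is 0, so a positive argument can only come from a genuine polar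
    form. The points of both sets have argument at least eps > 0, hence no general existence result
    for arguments is called for. *)
Lemma argcP lam : 0 < argc lam -> 0 <= argc lam < 2 * pi /\
  lam = (normc lam)%:C * cexp ((argc lam) *i).
Proof.
rewrite /argc; set P := [set t : R | _].
have [ex _|nex] := pselect (exists t, P t); first by have [] := xgetPex 0 ex.
by rewrite xgetPN ?ltxx // => t Pt; apply: nex; exists t.
Qed.

Lemma argc_polar (r : R) t : 0 < r -> 0 <= t < 2 * pi -> argc (r%:C * cexp (t *i)) = t.
Proof.
move=> r0 tP; rewrite /argc; set P := [set s : R | _].
have nr : normc (r%:C * cexp (t *i)) = r.
  by rewrite normcM normc_cexp /= expR0 mulr1 -[LHS]/(normc r%:C) normc_real gtr0_norm.
have : P (xget 0 P) by apply: xgetPex; exists t; split => //; rewrite nr.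
case=> sP; rewrite nr => e; apply: cexp_angle_inj => //; apply/esym.
have rC : r%:C != 0 :> R[i] by rewrite -normc_gt0 normc_real normr_gt0 gt_eqF.
exact: mulfI rC _ _ e.
Qed.

(** The sine is a decreasing function of the distance to pi/2 on [0, pi]. *)
Lemma sin_ge (d t : R) : 0 <= d -> d <= t -> t <= pi - d -> sin d <= sin t.
Proof.
move=> d0 dt td; have p0 := pi_gt0 R.
rewrite -[d](subrK (pi / 2)) -[t](subrK (pi / 2)) !sinDpihalf.
rewrite -(cos_norm (t - _)) -(cos_norm (d - _)) (ler0_norm (x := d - _)); last lra.
have h1 : `|t - pi / 2| <= pi / 2 - d by rewrite ler_norml; apply/andP; split; lra.
rewrite opprB; move: h1; rewrite le_eqVlt => /orP[/eqP-> //|h1].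
by rewrite ltW // ltr_cos // in_itv /= ?normr_ge0 /=; lra.
Qed.

Context {n kap p : nat} {lam : nat -> R[i]} {eps : R}.
Context (n_ge2 : (2 <= n)%N) (kap_le1 : (kap <= 1)%N) (eps_gt0 : 0 < eps)
  (lamP : forall m, lam m != 0 /\ pi * kap%:R + eps <= argc (lam m) <= pi * kap.+1%:R - eps).

Let rho m := rho_of n (lam m).

Let theta m : R := argc (lam m) / n%:R.

Let n0 : 0 < n%:R :> R. Proof. by rewrite ltr0n (leq_trans _ n_ge2). Qed.

Let argc_gt0 m : 0 < argc (lam m).
Proof.
have [_ /andP[h _]] := lamP m; apply: lt_le_trans h; rewrite ltr_wpDl //.
by rewrite mulr_ge0 // pi_ge0.
Qed.

Lemma normc_rho_of_gt0 m : 0 < normc (lam m) `^ n%:R^-1.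
Proof. by rewrite powR_gt0 // normc_gt0; have [] := lamP m. Qed.

Lemma normc_rho_of m : normc (rho m) = normc (lam m) `^ n%:R^-1.
Proof.
rewrite /rho /rho_of normcM normc_cexp /= expR0 mulr1 -[LHS]/(normc _%:C) normc_real.
by rewrite gtr0_norm ?normc_rho_of_gt0.
Qed.

Lemma rho_of_expn m : rho m ^+ n = lam m.
Proof.
have [_ lE] := argcP (argc_gt0 m); rewrite [RHS]lE /rho /rho_of exprMn -rmorphXn /=.
rewrite -powR_mulrn ?powR_ge0 // -powRrM mulVf ?gt_eqF // powRr1 ?normc_ge0 //.
rewrite -cexpMn; congr (_ * cexp _).
have aux (a : R) k : (a *i) *+ k = (a *+ k) *i :> R[i].
  by elim: k => [|k IH]; [apply/eqP; rewrite eq_complex /= !eqxx|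
     rewrite !mulrS IH; apply/eqP; rewrite eq_complex /= addr0 !eqxx].
by rewrite aux -[X in X *i = _]mulr_natr divfK // gt_eqF.
Qed.

Lemma theta_bounds m :
  (pi * kap%:R + eps) / n%:R <= theta m <= (pi * kap.+1%:R - eps) / n%:R.
Proof. by have [_ h] := lamP m; rewrite /theta !ler_pM2r ?invr_gt0. Qed.

Lemma argc_scaled m (c : R) : 0 < c -> argc (c%:C * rho m) = theta m.
Proof.
move=> c0; rewrite /rho /rho_of mulrA -rmorphM argc_polar //.
  by rewrite mulr_gt0 ?normc_rho_of_gt0.
have [/andP[h0 h1] _] := argcP (argc_gt0 m).
rewrite divr_ge0 ?ltW //= ltr_pdivrMr //; apply: lt_le_trans h1 _.
by rewrite ler_peMr ?mulr_ge0 ?pi_ge0 // ler1n (leq_trans _ n_ge2).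
Qed.

Lemma rho_sector_interior m (c : R) : 0 < c -> sector_interior n kap (c%:C * rho m).
Proof.
move=> c0; split.
  rewrite -normc_gt0 normcM normc_real mulr_gt0 ?normr_gt0 ?gt_eqF //.
  by rewrite normc_rho_of normc_rho_of_gt0.
rewrite argc_scaled //; have /andP[h1 h2] := theta_bounds m.
apply/andP; split; [apply: lt_le_trans h1|apply: le_lt_trans h2 _];
  by rewrite ltr_pM2r ?invr_gt0 // ?ltrDl // gtrBl.
Qed.

Lemma Im_rho_root m (j : 'I_n) : complex.Im (rho m * root_unity R n j) =
  normc (rho m) * sin (theta m + 2 * pi * j%:R / n%:R).
Proof.
have -> : rho m * root_unity R n j =
    (normc (rho m))%:C * cexp ((theta m + 2 * pi * j%:R / n%:R) *i).
  rewrite normc_rho_of /rho /rho_of /root_unity -mulrA -cexpD; congr (_ * cexp _).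
  by apply/eqP; rewrite eq_complex /= addr0 !eqxx.
by rewrite /cexp /= expR0; ring.
Qed.

(** With N = 2j + kap, the argument of rho eps_j lies in [pi N/n, pi (N + 1)/n] at distance at least
    eps/n from both ends. As N is an integer, this interval lies in [0, pi] if N < n and in
    [pi, 2 pi] otherwise; the upper end 2 pi uses j <= n - 1 and kap <= 1. *)
Lemma sin_dichotomy m (j : 'I_n) :
  if (2 * j + kap < n)%N then sin (eps / n%:R) <= sin (theta m + 2 * pi * j%:R / n%:R)
  else sin (theta m + 2 * pi * j%:R / n%:R) <= - sin (eps / n%:R).
Proof.
have /andP[h1 h2] := theta_bounds m; have p0 := pi_gt0 R.
have d0 : 0 <= eps / n%:R by rewrite divr_ge0 // ltW.
set N := (2 * j + kap)%N; set x := theta m + _.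
have x1 : (pi * N%:R + eps) / n%:R <= x.
  rewrite (_ : _ / _ = (pi * kap%:R + eps) / n%:R + 2 * pi * j%:R / n%:R) ?lerD2r //.
  by rewrite /N natrD natrM; field; rewrite gt_eqF.
have x2 : x <= (pi * N.+1%:R - eps) / n%:R.
  rewrite (_ : _ / n%:R = (pi * kap.+1%:R - eps) / n%:R + 2 * pi * j%:R / n%:R) ?lerD2r //.
  by rewrite /N -!natr1 natrD natrM; field; rewrite gt_eqF.
have sc (a : R) : pi * a / n%:R = pi * (a / n%:R) by rewrite mulrA.
rewrite mulrDl sc in x1; rewrite mulrBl sc in x2.
have leN (a b : nat) : (a <= b * n)%N -> pi * (a%:R / n%:R) <= pi * b%:R :> R.
  by move=> ab; rewrite ler_pM2l // ler_pdivrMr // -natrM ler_nat.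
have geN (a b : nat) : (b * n <= a)%N -> pi * b%:R <= pi * (a%:R / n%:R) :> R.
  by move=> ab; rewrite ler_pM2l // ler_pdivlMr // -natrM ler_nat.
case: ltnP => Nn.
  apply: sin_ge => //; first by have := geN N 0%N (leq0n _); lra.
  by have := leN N.+1 1%N; rewrite mul1n => /(_ Nn); lra.
have jn := ltn_ord j; rewrite (_ : sin x = - sin (x - pi)); last first.
  by rewrite -[in LHS](subrK pi x) sinDpi.
rewrite lerN2; apply: sin_ge => //.
  by have := geN N 1%N; rewrite mul1n => /(_ Nn); lra.
have h : (N.+1 <= 2 * n)%N.
  by rewrite /N -addnS (@leq_trans (2 * j + 2)) ?leq_add2l // -mulnSr leq_mul2l.
by have := leN N.+1 2%N h; lra.
Qed.

Context (lam_infty : normc (lam m) @[m --> \oo] --> +oo) (eps_lt_pi : eps < pi)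
  (decay : decay_index R n kap p).

Let c0 : R := sin (eps / n%:R).

Let c0_gt0 : 0 < c0.
Proof.
apply: sin_gt0_pi; rewrite divr_gt0 //= ltr_pdivrMr //; apply: lt_le_trans eps_lt_pi _.
by rewrite ler_peMr ?pi_ge0 // ler1n (leq_trans _ n_ge2).
Qed.

(** [decay_index] fixes p through signs inside the sector; evaluating it at [rho m] links p with the
    explicit condition 2j + kap < n. *)
Lemma Im_rho_sign m (j : 'I_n) :
  (0 < sin (theta m + 2 * pi * j%:R / n%:R)) = (j < p)%N.
Proof.
have [_ /(_ (rho m)) h] := decay; have ri := rho_sector_interior m ltr01.
rewrite complex1 mul1r in ri; have {h} := h ri j; rewrite Im_rho_root.
rewrite pmulr_rgt0; last by rewrite normc_rho_of normc_rho_of_gt0.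
by move=> h; apply/idP/idP => /h.
Qed.

(** Here n >= 2 enters: the index 0 satisfies kap < n, while for n - 1 one has 2(n - 1) + kap >= n.
    Hence z_0 lives at the endpoint 0 and z_(n-1) at 1, as the two families of corrections
    require. *)
Lemma decay_index_gt0 : (0 < p)%N.
Proof.
have nn : (0 < n)%N by exact: leq_trans n_ge2.
have := sin_dichotomy 0 (Ordinal nn); have := Im_rho_sign 0 (Ordinal nn).
rewrite /= muln0 add0n (leq_trans _ n_ge2) ?ltnS // => <- h.
exact: lt_le_trans h.
Qed.

Lemma decay_index_ltn : (p < n)%N.
Proof.
have nn : (n.-1 < n)%N by rewrite prednK // (leq_trans _ n_ge2).
have n1 : (1 <= n.-1)%N by rewrite -ltnS prednK // (leq_trans _ n_ge2).
have hn : (2 * n.-1 + kap < n)%N = false.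
  apply/negbTE; rewrite -leqNgt -{1}(prednK (ltnW n_ge2)) mul2n -addnn -addnA -addn1.
  by rewrite leq_add2l ltn_addr.
have := sin_dichotomy 0 (Ordinal nn); have := Im_rho_sign 0 (Ordinal nn); rewrite /= hn.
move=> e h; rewrite ltnNge; apply/negP => np.
have : (n.-1 < p)%N by exact: leq_trans np.
by rewrite -e ltNge (le_trans h) // oppr_le0 ltW.
Qed.

Lemma rho_of_dichotomous : dichotomous_sequence R n kap p c0 rho.
Proof.
split=> // [m c cc0||m j].
- by have [? /andP[h1 h2]] := rho_sector_interior m cc0; split; rewrite // (ltW h1).
- apply/cvgryPge => A; move/cvgryPge: lam_infty => /(_ ((`|A| + 1) ^+ n)).
  apply: filterS => m; rewrite -rho_of_expn normc_expn => h.
  have A1 : 0 <= `|A| + 1 by rewrite addr_ge0.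
  rewrite ler_pXn2r ?nnegrE ?normc_ge0 // in h; last by rewrite (leq_trans _ n_ge2).
  by apply: le_trans h; rewrite (le_trans (ler_norm A)) // lerDl.
have := sin_dichotomy m j; have := Im_rho_sign m j; rewrite Im_rho_root.
rewrite -/c0; set s := sin _ => e d; have r0 := normc_ge0 (rho m).
case: ifP => jp; rewrite jp in e.
  rewrite [leLHS]mulrC ler_wpM2l //.
  by move: d; case: ltnP => // _ d; move: c0_gt0; lra.
rewrite -mulNr [leRHS]mulrC ler_wpM2l //.
by move: d; case: ltnP => // _ d; move/negbT: e; rewrite -leNgt; move: c0_gt0; lra.
Qed.

End Sectors.

(** * The limit relations *)

Section Limits.
Context {R : realType} {n : nat} {pc : 'I_n.-1 -> R -> R[i]} {kap p : nat}
  {y : R[i] -> 'I_n -> R -> R[i]} {r0 M c0 : R} {lam : nat -> R[i]}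
  {B : bdry_cond R n} {A : R[i] -> 'M[R[i]]_n}.
Local Set Implicit Arguments.
Local Unset Strict Implicit.
Let rho m := rho_of n (lam m).
Context (ysol : solutions_asymptotic R n pc kap y r0 M)
  (rhoP : dichotomous_sequence R n kap p c0 rho) (p_gt0 : (0 < p)%N) (p_ltn : (p < n)%N)
  (charA : characteristic_matrix B kap p y A).

Let Th01 := Theta p (bc_b0 B) (bc_b1 B).
Let Th10 := Theta p (bc_b1 B) (bc_b0 B).

Let n0 : (0 < n)%N. Proof. exact: leq_ltn_trans p_ltn. Qed.

Let twopi_neq0 : (2 * pi)%:C != 0 :> R[i].
Proof. by rewrite -normc_gt0 normc_real normr_gt0 mulf_neq0 // gt_eqF // pi_gt0. Qed.

(** The diagonal of [Dmx] in the form used by [characteristic_matrix]. *)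
Definition dcoef (t : 'I_n) : R[i] :=
  if (t < p)%N then root_unity R n t / (2 * pi)%:C else - (root_unity R n t / (2 * pi)%:C).

Lemma dcoef_neq0 t : dcoef t != 0.
Proof.
by rewrite /dcoef; case: ifP => _; rewrite ?oppr_eq0 mulf_neq0 ?invr_eq0 ?root_unity_neq0 ?twopi_neq0.
Qed.

Lemma mulmx_Dmx (X : 'M[R[i]]_n) i t : (X *m Dmx R n p) i t = X i t * dcoef t.
Proof.
rewrite /Dmx -scalemxAr mxE mul_mx_diag !mxE /dcoef fmorphV.
by case: ifP => _; ring.
Qed.

(** The equations for the columns of A are available only where det Delta is nonzero. Since Delta
    tends to an invertible matrix this holds for large m, and there A is the inverse of Delta times
    the matrix of scaled columns beta_t. *)
Lemma characteristic_tends : Th01 \in unitmx ->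
  mx_tends (fun m => A (rho m)) (invmx Th01 *m Th10 *m Dmx R n p).
Proof.
move=> Thu; have DTh := Delta_tends n0 ysol rhoP (B := B).
pose Rm m : 'M[R[i]]_n := \matrix_(i, t) (dcoef t * beta B p y (rho m) t i 0).
have RmT : mx_tends Rm (Th10 *m Dmx R n p).
  move=> i t; rewrite mulmx_Dmx; under [X in tends X]eq_fun do rewrite mxE.
  rewrite mulrC; apply: tendsM; first exact: tends_cst.
  exact: (beta_tends n0 ysol rhoP).
have [rA charA'] := charA.
have AE : \forall m \near \oo, A (rho m) = invmx (Delta B p y (rho m)) *m Rm m.
  have sec := near_sector (r0 := rA) rhoP (lexx 1); have du := mx_tends_unit Thu DTh.
  near=> m.
  have Du : Delta B p y (rho m) \in unitmx by near: m.
  have [ss rs] : sector n kap (rho m) /\ rA <= normc (rho m).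
    by near: m; move: sec; apply: filterS => m; rewrite complex1 mul1r.
  have dn : \det (Delta B p y (rho m)) != 0 by rewrite -unitfE -unitmxE.
  have h := charA' _ ss rs dn.
  rewrite -[A (rho m)](mulKmx Du); congr (_ *m _); apply/matrixP => i t.
  have := h t; rewrite colE mulmxA -colE => /matrixP/(_ i 0).
  by rewrite [LHS]mxE => ->; rewrite mxE [RHS]mxE.
rewrite -mulmxA => i j.
apply: (tends_near (v := fun m => (invmx (Delta B p y (rho m)) *m Rm m) i j)).
  by move: AE; apply: filterS => m ->.
by apply: (mx_tendsM (mx_tends_inv Thu DTh) RmT).
Unshelve. all: by end_near.
Qed.

(** As 0 < p < n, the column 0 of this matrix comes from b^1 and the column n - 1 from b^0. If both
    vanish, so do all leading coefficients, and then the invertible matrix [Th01] would be zero. *)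
Lemma Theta_swap_neq0 : Th01 \in unitmx -> Th10 != 0.
Proof.
move=> Thu; apply/eqP => Th0.
have nn : (n.-1 < n)%N by rewrite prednK.
have pn : (p <= n.-1)%N by rewrite -ltnS prednK.
have col0 (k : 'I_n) (u : forall j, 'cV[R[i]]_(bc_r B j)) :
    (forall i, Bcol u k i 0 = 0) -> forall j, u j = 0.
  move=> uk j; have : Bcol u k = 0.
    by apply/matrixP => i z; rewrite (ord1 z) uk mxE.
  move=> /stack_eq0/(_ j)/eqP; rewrite scaler_eq0 expf_eq0.
  by rewrite (negbTE (root_unity_neq0 _)) andbF => /eqP.
have b1 : forall j, bc_b1 B j = 0.
  apply: (col0 (Ordinal n0)) => i; have /matrixP/(_ i (Ordinal n0)) := Th0.
  by rewrite !mxE /= p_gt0.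
have b0 : forall j, bc_b0 B j = 0.
  apply: (col0 (Ordinal nn)) => i; have /matrixP/(_ i (Ordinal nn)) := Th0.
  by rewrite !mxE /= ltnNge pn.
have Z : Th01 = 0.
  apply/matrixP => i k; rewrite !mxE /Bcol; have [j [l lE]] := stack_entry B i.
  by case: ifP => _; rewrite lE mxE ?b0 ?b1 mxE mulr0.
(* The zero matrix has determinant 0 only in positive size. *)
by move: Thu; rewrite Z unitmxE unitfE; case: n n0 => [//|n'] _; rewrite det0 eqxx.
Qed.

Lemma limit_relations_of_unit : Th01 \in unitmx -> limit_relations B p y A lam.
Proof.
move=> Thu; exists Th01, (invmx Th01 *m Th10 *m Dmx R n p).
have Th01n : Th01 != 0.
  apply/eqP => Z; move: Thu; rewrite Z unitmxE unitfE.
  by case: n n0 => [//|n'] _; rewrite det0 eqxx.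
have Th10n := Theta_swap_neq0 Thu.
have D0 (X : 'M[R[i]]_n) : X *m Dmx R n p = 0 -> X = 0.
  move=> XD; apply/matrixP => i t; have /matrixP/(_ i t) := XD.
  rewrite mulmx_Dmx !mxE => /eqP; rewrite mulf_eq0 (negbTE (dcoef_neq0 t)) orbF.
  by move=> /eqP.
have An : invmx Th01 *m Th10 *m Dmx R n p != 0.
  apply/eqP => /D0 Z; move/eqP: Th10n; apply.
  by rewrite -[Th10](mulKVmx Thu) Z mulmx0.
have Dn : Dmx R n p != 0.
  by apply/eqP => Z; move/eqP: Th01n; apply; apply: D0; rewrite Z mulmx0.
have DT := mx_tends_cvg (Delta_tends n0 ysol rhoP (B := B)).
have AT := mx_tends_cvg (characteristic_tends Thu).
exact: (conj (And5 DT erefl Thu AT erefl) (And5 Th01n Th01n Th10n Dn An)).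
Qed.

End Limits.

(** The half-plane is a parameter: [kap] = 0 gives arguments between eps and pi - eps, [kap] = 1 the
    same range shifted by pi. *)
Lemma limit_relations_sector (R : realType) (n kap p : nat) (pc : 'I_n.-1 -> R -> R[i])
    (B : bdry_cond R n) (y : R[i] -> 'I_n -> R -> R[i]) (A : R[i] -> 'M[R[i]]_n)
    (lam : nat -> R[i]) (eps : R) (T : set R[i]) :
  (2 <= n)%N -> (kap <= 1)%N -> 0 < eps -> eps < pi ->
  (forall z, T z -> z != 0 /\ pi * kap%:R + eps <= argc z <= pi * kap.+1%:R - eps) ->
  decay_index R n kap p -> fundamental_system pc kap y ->
  characteristic_matrix B kap p y A -> resolvent_sequence pc B T lam ->
  limit_relations B p y A lam.
Proof.
move=> n2 kap1 e0 epi TP dec [r0 [M ysol]] charA [lamT laminf [C resC]].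
have lamP m := TP _ (lamT m).
have p0 := decay_index_gt0 n2 kap1 e0 lamP epi dec.
have pn := decay_index_ltn n2 kap1 e0 lamP epi dec.
have rhoP := rho_of_dichotomous n2 kap1 e0 lamP laminf epi dec.
apply: (limit_relations_of_unit ysol rhoP p0 pn charA).
apply: (Theta_unitmx ysol rhoP p0 pn (lam := lam) (C := C)) => m.
  by rewrite (rho_of_expn n2 e0 lamP).
by have [] := resC m.
Qed.

Theorem theorem5p1 (R : realType) (n : nat) (n_ge2 : (2 <= n)%N)
    (pc : 'I_n.-1 -> R -> R[i]) (pc_L1 : forall k, L1_01 (pc k))
    (B : bdry_cond R n) (eps : R) (eps_gt0 : 0 < eps) (eps_lt_pi : eps < pi) :
  (forall (p : nat) (y : R[i] -> 'I_n -> R -> R[i]) (A : R[i] -> 'M[R[i]]_n)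
      (lam : nat -> R[i]),
    decay_index R n 1 p ->
    fundamental_system pc 1 y ->
    characteristic_matrix B 1 p y A ->
    resolvent_sequence pc B (Tminus eps) lam ->
    limit_relations B p y A lam) /\
  (forall (p : nat) (y : R[i] -> 'I_n -> R -> R[i]) (A : R[i] -> 'M[R[i]]_n)
      (lam : nat -> R[i]),
    decay_index R n 0 p ->
    fundamental_system pc 0 y ->
    characteristic_matrix B 0 p y A ->
    resolvent_sequence pc B (Tplus eps) lam ->
    limit_relations B p y A lam).
Proof.
split=> p y A lam.
  apply: (limit_relations_sector R n 1 p pc B y A lam eps) => // z [z0 zP]; split => //.
  by rewrite mulr1 (mulrC pi).
apply: (limit_relations_sector R n 0 p pc B y A lam eps) => // z [z0 zP]; split => //.
by rewrite mulr0 add0r mulr1.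
Qed.
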